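(* Let $T$ be a theory in a countable relational vocabulary $\tau$ and $n\geq 2$. The following are equivalent: (1) $T$ has a $\forall_n$-axiomatization but no $\forall_{n-1}$-axiomatization; (2) the Wadge degree of $\mathrm{Mod}(T)$ lies in the interval $[\boldsymbol\Sigma^0_{n-1},\boldsymbol\Pi^0_n]$, i.e., $\mathrm{Mod}(T)\in\boldsymbol\Pi^0_n$ and $\mathrm{Mod}(T)$ is $\boldsymbol\Sigma^0_{n-1}$-hard.
   Context: $\mathrm{Mod}(\tau)\subseteq 2^\omega$ is the Polish space of atomic diagrams of $\tau$-structures with universe $\omega$; $\mathrm{Mod}(T)$ is the subset of models of $T$. $T$ has a $\forall_n$-axiomatization if some set of $\forall_n$-sentences (prenex, $n$ alternating quantifier blocks starting with $\forall$) has the same deductive closure as $T$. A set is $\Gamma$-hard if every $\Gamma$ subset of $2^\omega$ continuously (Wadge) reduces to it. Complete theories considered are assumed to have infinite models.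
   Formalization: ''Same deductive closure'' is read as having the same consequences over infinite structures; with finite models counted the claim fails, e.g. for the theory of an infinite set with empty E (∀_2, not ∀_1, yet Mod(T) is closed, so not Σ^0_1-hard). *)

(* Defs.v *)
From HB Require Import structures.
From mathcomp Require Import all_boot all_order all_algebra.
From mathcomp Require Import all_classical all_reals topology cantor.
Set Implicit Arguments.
Unset Strict Implicit.
Unset Printing Implicit Defensive.
Local Open Scope classical_set_scope.

Section Syntax.
Variables (sym : countType) (ar : sym -> nat).

Inductive fo_form : Type :=
  | FBot : fo_form
  | FEq : nat -> nat -> fo_form
  | FRel : forall R : sym, ('I_(ar R) -> nat) -> fo_form
  | FNeg : fo_form -> fo_form
  | FAnd : fo_form -> fo_form -> fo_form
  | FOr : fo_form -> fo_form -> fo_form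
  | FImp : fo_form -> fo_form -> fo_form
  | FAll : nat -> fo_form -> fo_form
  | FEx : nat -> fo_form -> fo_form.

Fixpoint qfree (f : fo_form) : Prop :=
  match f with
  | FBot | FEq _ _ | FRel _ _ => True
  | FNeg g => qfree g
  | FAnd g h | FOr g h | FImp g h => qfree g /\ qfree h
  | FAll _ _ | FEx _ _ => False
  end.

(* Prenex classes: [PiF n f] : f is a prenex forall_n formula (n alternating,
   possibly empty, quantifier blocks starting with forall, then a
   quantifier-fo_free matrix); [SigF n f] dually. *)
Inductive PiF : nat -> fo_form -> Prop :=
  | PiF0 f : qfree f -> PiF 0 f
  | PiF_blk n f : SigF n f -> PiF n.+1 f
  | PiF_all n x f : PiF n.+1 f -> PiF n.+1 (FAll x f)
with SigF : nat -> fo_form -> Prop :=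
  | SigF0 f : qfree f -> SigF 0 f
  | SigF_blk n f : PiF n f -> SigF n.+1 f
  | SigF_ex n x f : SigF n.+1 f -> SigF n.+1 (FEx x f).

Fixpoint fo_free (x : nat) (f : fo_form) : Prop :=
  match f with
  | FBot => False
  | FEq a b => a = x \/ b = x
  | FRel R a => exists i, a i = x
  | FNeg g => fo_free x g
  | FAnd g h | FOr g h | FImp g h => fo_free x g \/ fo_free x h
  | FAll y g | FEx y g => y <> x /\ fo_free x g
  end.

Definition sentence (f : fo_form) : Prop := forall x, ~ fo_free x f.

Record structure := Structure {
  carrier :> Type;
  elt0 : carrier;   (* universes are nonempty *)
  interp : forall R : sym, ('I_(ar R) -> carrier) -> Prop }.

Definition upd (M : Type) (v : nat -> M) (x : nat) (m : M) : nat -> M :=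
  fun y => if y == x then m else v y.

Fixpoint fo_eval (M : structure) (v : nat -> M) (f : fo_form) : Prop :=
  match f with
  | FBot => False
  | FEq a b => v a = v b
  | FRel R a => interp (fun i => v (a i))
  | FNeg g => ~ fo_eval v g
  | FAnd g h => fo_eval v g /\ fo_eval v h
  | FOr g h => fo_eval v g \/ fo_eval v h
  | FImp g h => fo_eval v g -> fo_eval v h
  | FAll x g => forall m : M, fo_eval (upd v x m) g
  | FEx x g => exists m : M, fo_eval (upd v x m) g
  end.

Definition fo_sat (M : structure) (f : fo_form) : Prop := forall v : nat -> M, fo_eval v f.

Definition infinite_structure (M : structure) : Prop :=
  exists g : nat -> M, injective g.

Definition conseq (T : set fo_form) (f : fo_form) : Prop :=
  sentence f /\
  forall M : structure, infinite_structure M ->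
    (forall g, T g -> fo_sat M g) -> fo_sat M f.

Definition has_forall_axiomatization (T : set fo_form) (n : nat) : Prop :=
  exists Ax : set fo_form,
    (forall f, Ax f -> sentence f /\ PiF n f) /\
    (forall f, conseq Ax f <-> conseq T f).

(* Atomic facts R(a_0,...,a_{k-1}) with a_i in omega, enumerated injectively
   into omega by [pickle]. *)
Definition fact := {R : sym & {ffun 'I_(ar R) -> nat}}.

Definition code_fact (R : sym) (a : 'I_(ar R) -> nat) : nat :=
  pickle (Tagged (fun R => {ffun 'I_(ar R) -> nat}) [ffun i => a i]).

(* Mod(tau): the elements of 2^omega that are atomic diagrams, i.e. whose
   bits outside the codes of atomic facts are 0. *)
Definition ModTau : set cantor_space :=
  [set x | forall k, x k = true -> exists c : fact, pickle c = k].

Definition struct_of (x : cantor_space) : structure :=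
  @Structure nat 0 (fun R a => x (code_fact a) = true).

Definition ModT (T : set fo_form) : set cantor_space :=
  [set x | ModTau x /\ forall f, T f -> fo_sat (struct_of x) f].

End Syntax.

Section Borel.
Variable X : topologicalType.

(* SigmaB k = boldface Sigma^0_{k+1}. *)
Fixpoint SigmaB (k : nat) : set (set X) :=
  match k with
  | 0 => [set A | open A]
  | k'.+1 => [set A | exists F : nat -> set X,
                 (forall i, SigmaB k' (~` F i)) /\ A = \bigcup_i F i]
  end.

(* Sigma0 m = boldface Sigma^0_m for m >= 1 (Sigma0 0 := clopen sets, unused). *)
Definition Sigma0 (m : nat) : set (set X) :=
  match m with
  | 0 => [set A | open A /\ closed A]
  | k.+1 => SigmaB k
  end.

Definition Pi0 (m : nat) : set (set X) := [set A | Sigma0 m (~` A)].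
End Borel.
Arguments SigmaB : clear implicits.
Arguments Sigma0 : clear implicits.
Arguments Pi0 : clear implicits.

Definition hard (sym : countType) (ar : sym -> nat)
    (Gamma : set (set cantor_space)) (B : set cantor_space) : Prop :=
  forall A : set cantor_space, Gamma A ->
    exists f : cantor_space -> cantor_space,
      continuous f /\ (forall y, ModTau ar (f y)) /\ (forall y, A y <-> B (f y)).

(* Main.v *)
(* If [T] has no forall_n-axiomatization, there are M not a model of T and N |= T, both
   omega_1-saturated ultraproducts, such that every forall_n-sentence true in N is true in M.
   For a Sigma^0_n set A the reduction builds, for each y, a countable elementary substructure
   of N if y is in A and of M otherwise. Finite pieces are tuples from M or N attached to the
   initial segments of y. A nested family of "true stage" relations of levels 0, ..., n-1 makes
   A open at the top level, and the tuple at a stage preserves the forall_k-type of the tuple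
   at each earlier stage that looks true at level k. Saturation allows one to return to the
   older structure when a guess fails. Hardness then gives the lower bounds, while the upper
   bounds come from the syntax; the Borel hierarchy being strict yields the converse. *)

Require Import Defs.
From HB Require Import structures.
From mathcomp Require Import all_boot all_order all_algebra.
From mathcomp Require Import all_classical all_reals topology cantor.
Set Implicit Arguments.
Unset Strict Implicit.
Unset Printing Implicit Defensive.
Local Open Scope classical_set_scope.

(** * The Borel hierarchy on Cantor space *)

(** Each return to an older structure costs one quantifier. Preserving the forall_{k+1}-type of a
    tuple only ensures that every finite part of the forall_k-type of a longer tuple is realized
    over it; saturation turns this into one tuple realizing all of it. Hence n-1 lifts bring a tuple
    from level 0 to level n-1, and the preservation of forall_n-sentences pays for one more, the
    switch from M to N, which starts at the empty tuple of N. The universe of the result is omega: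
    number i names the i-th entry of the current tuple, and may name other elements, even in the
    other structure, at another stage. Preservation at level 0 freezes the atomic diagram and gives
    continuity, while only the top-level true stages (late enough for the guess to be stable) form
    one growing tuple, along which Tarski-Vaught requests are served. Entries of a tuple are
    distinct because distinct numbers are distinct elements; this is where infinite structures are
    needed. *)

Definition agree (m : nat) (y z : nat -> bool) := forall i, (i < m)%N -> y i = z i.

Lemma nbhs_agree (y : cantor_space) (m : nat) : nbhs y [set z : cantor_space | agree m y z].
Proof.
elim: m => [|m IH]; first by apply: filterS filterT => z _ i.
have Hm : nbhs y [set z : cantor_space | z m = y m].
  have /(_ [set y m]) := @proj_continuous nat (fun=> bool) m y.
  by apply; apply: open_nbhs_nbhs; split => //; exact: discrete_open.
apply: filterS (filterI IH Hm) => z [zy zm] i.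
by rewrite ltnS leq_eqVlt => /orP[/eqP->|/zy].
Qed.

Lemma openP (A : set cantor_space) :
  open A <-> forall y, A y -> exists m, forall z, agree m y z -> A z.
Proof.
split => [Ao y Ay|H]; last first.
  rewrite openE => y /H[m Hm]; rewrite /interior /=.
  by apply: filterS (nbhs_agree y m) => z /Hm.
pose F : set_system cantor_space :=
  filter_from setT (fun m => [set z : cantor_space | agree m y z]).
have FF : Filter F.
  apply: filter_from_filter; first by exists 0.
  move=> i j _ _; exists (maxn i j) => // z Hz; split => k Hk; apply: Hz;
    by rewrite leq_max Hk ?orbT.
have cF : F --> y.
  apply/pointwise_cvgP => t B /= HB.
  exists t.+1 => // z Hz /=; rewrite /= -(Hz t) //; exact: nbhs_singleton HB.
have [m _ Hm] : F A by apply: cF; exact: open_nbhs_nbhs.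
by exists m.
Qed.

Lemma continuous_agree (f : cantor_space -> cantor_space) :
  (forall k, exists m, forall y z, agree m y z -> f y k = f z k) -> continuous f.
Proof.
move=> H; apply/continuousP => A /openP Ao; apply/openP => y /= /Ao [m Hm].
have [M HM] : exists M, forall z, agree M y z -> agree m (f y) (f z).
  elim: m {Hm} => [|m [M IH]]; first by exists 0.
  have [M' HM'] := H m; exists (maxn M M') => z Hz i.
  rewrite ltnS leq_eqVlt => /orP[/eqP->|im].
    by apply: HM' => j jM; apply: Hz; rewrite leq_max jM orbT.
  by apply: IH im => j jM; apply: Hz; rewrite leq_max jM.
by exists M => z /HM /Hm.
Qed.

Section BorelClosure.
Variable X : topologicalType.
Implicit Types A B : set X.

Lemma SigmaB_clopen k A : open A -> open (~` A) -> SigmaB X k A.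
Proof.
elim: k A => [|k IH] A Ao Aco //=.
exists (fun=> A); split; last by rewrite bigcup_const //; exists 0.
by move=> _; apply: IH; rewrite // setCK.
Qed.

Lemma SigmaB_compl k A : SigmaB X k (~` A) -> SigmaB X k.+1 A.
Proof. by exists (fun=> A); split => //; rewrite bigcup_const //; exists 0. Qed.

Lemma SigmaB_bigcup k (F : nat -> set X) :
  (forall i, SigmaB X k (F i)) -> SigmaB X k (\bigcup_i F i).
Proof.
case: k => [|k] /= HF; first by apply: bigcup_open => i _.
have [G HG] := choice HF.
exists (fun m => if @unpickle (nat * nat)%type m is Some ij then G ij.1 ij.2 else G 0 0).
split => [m|]; first by case: unpickle => [[i j]|]; apply (HG _).1.
apply/seteqP; split => x.
  move=> [i _]; rewrite (HG i).2 => -[j _ Gx].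
  by exists (pickle (i, j)) => //; rewrite pickleK.
move=> [m _]; case: unpickle => [[i j]|] Gx.
  by exists i => //; rewrite (HG _).2; exists j.
by exists 0 => //; rewrite (HG _).2; exists 0.
Qed.

Lemma SigmaB_preimage (Y : topologicalType) (f : Y -> X) k A :
  continuous f -> SigmaB X k A -> SigmaB Y k (f @^-1` A).
Proof.
move=> /continuousP cf; elim: k A => [|k IH] A /=; first exact: cf.
move=> [F [HF ->]]; exists (fun i => f @^-1` F i).
by rewrite preimage_bigcup; split => // i; apply: IH (HF i).
Qed.

End BorelClosure.

(** * Universal sets and the strictness of the Borel hierarchy *)

Section Diagonal.

Definition slice (i : nat) (z : nat -> bool) : nat -> bool :=
  fun j => z (pickle (i, j)).

(** Universal sets: [z] codes an open set by the codes of its cylinders, and at higher levels the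
    slices of [z] code the complements of the sets to be united. *)
Fixpoint univ (k : nat) (z : nat -> bool) : set cantor_space :=
  match k with
  | 0 => [set y | exists s : seq bool, z (pickle s) /\
             forall i, (i < size s)%N -> y i = nth false s i]
  | k'.+1 => [set y | exists i, ~ univ k' (slice i z) y]
  end.

Lemma univ_surj k (A : set cantor_space) : SigmaB _ k A -> exists z, univ k z = A.
Proof.
elim: k A => [|k IH] A /=.
  move=> /openP Ao.
  exists (fun m => `[< exists s : seq bool, pickle s = m /\ forall y : cantor_space,
     (forall i, (i < size s)%N -> y i = nth false s i) -> A y >]).
  apply/seteqP; split => y /=.
    by move=> [s [/asboolP[t [/(pcan_inj pickleK) -> +]]] Hs]; apply.
  move=> /Ao [m Hm]; exists (mkseq y m); rewrite size_mkseq; split; last first.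
    by move=> i im; rewrite nth_mkseq.
  apply/asboolP; exists (mkseq y m); split => // y'; rewrite size_mkseq => H.
  by apply: Hm => i im; rewrite H // nth_mkseq.
move=> [F [HF ->]].
have /choice[z Hz] : forall i, exists z, univ k z = ~` F i by move=> i; apply: IH.
exists (fun m => if @unpickle (nat * nat)%type m is Some ij then z ij.1 ij.2 else false).
have Hs i : slice i (fun m => if @unpickle (nat * nat)%type m is Some ij
    then z ij.1 ij.2 else false) = z i by apply/funext => j; rewrite /slice pickleK.
apply/seteqP; split => y /=.
  by move=> [i]; rewrite Hs Hz => Fi; exists i => //; apply: contrapT.
by move=> [i _ Fi]; exists i; rewrite Hs Hz; apply.
Qed.

(** The code varies with the point through a continuous [h] because the induction passes to slices
    of it; the diagonal is the case of the identity. *)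
Lemma univ_SigmaB k (h : cantor_space -> cantor_space) :
  continuous h -> SigmaB _ k [set y | univ k (h y) y].
Proof.
elim: k h => [|k IH] h ch /=.
  apply/openP => y /= [s [zs ys]].
  have /openP/(_ y)[|m Hm] : open (h @^-1` [set z : cantor_space | z (pickle s)]).
  - move/continuousP : ch; apply; apply/openP => z /= zz.
    by exists (pickle s).+1 => z' /(_ (pickle s)) <-.
  - exact: zs.
  exists (maxn m (size s)) => z Hz; exists s; split.
    by apply: Hm => i im; apply: Hz; rewrite leq_max im.
  by move=> i im; rewrite -ys // Hz // leq_max im orbT.
exists (fun i => [set y | ~ univ k (slice i (h y)) y]); split.
  move=> i; have -> : ~` [set y | ~ univ k (slice i (h y)) y] =
      [set y | univ k (slice i (h y)) y].
    by apply/seteqP; split => y /=; [exact: contrapT | move=> ? ?].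
  apply: (IH (slice i \o h)) => y.
  apply: continuous_comp; first exact: ch.
  apply: (@continuous_agree (slice i)) => j; exists (pickle (i, j)).+1 => y1 y2.
  by move=> /(_ (pickle (i, j))) H; rewrite /slice H.
by apply/seteqP; split => y /= [i]; [exists i | move=> _; exists i].
Qed.

(** Cantor's diagonal argument for the universal set. *)
Lemma SigmaB_not_compl k :
  exists A : set cantor_space, SigmaB _ k A /\ ~ SigmaB _ k (~` A).
Proof.
exists [set y | univ k y y]; split; first by apply: (@univ_SigmaB k id) => y; exact: cvg_id.
move=> /univ_surj [z /seteqP[H1 H2]].
have Hz : ~ univ k z z by move=> H; apply: (H1 z H).
by apply: (Hz); apply: H2.
Qed.

End Diagonal.

(** * Prenex formulas *)

Section Formulas.
Variables (sym : countType) (ar : sym -> nat).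
Notation form := (fo_form ar).
Notation struct := (structure ar).
Implicit Types (f g h : form) (M : struct).

Lemma fo_eval_ext f M (v w : nat -> M) :
  (forall x, fo_free x f -> v x = w x) -> fo_eval v f <-> fo_eval w f.
Proof.
elim: f v w => [|a b|R a|f IH|f IHf g IHg|f IHf g IHg|f IHf g IHg|x f IH|x f IH] v w H /=.
- by [].
- by rewrite (H a) ?(H b) /=; auto.
- have -> // : (fun i => v (a i)) = (fun i => w (a i)).
  by apply/funext => i; apply: H; exists i.
- by have := IH v w H; tauto.
- by have := IHf v w (fun x Hx => H x (or_introl Hx));
     have := IHg v w (fun x Hx => H x (or_intror Hx)); tauto.
- by have := IHf v w (fun x Hx => H x (or_introl Hx));
     have := IHg v w (fun x Hx => H x (or_intror Hx)); tauto.
- by have := IHf v w (fun x Hx => H x (or_introl Hx));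
     have := IHg v w (fun x Hx => H x (or_intror Hx)); tauto.
- have Hm m : fo_eval (upd v x m) f <-> fo_eval (upd w x m) f.
    apply: IH => y fy; rewrite /upd; case: eqVneq => // /eqP yx.
    by apply: H; split => // xy; apply: yx.
  by split => H' m; apply/Hm.
- have Hm m : fo_eval (upd v x m) f <-> fo_eval (upd w x m) f.
    apply: IH => y fy; rewrite /upd; case: eqVneq => // /eqP yx.
    by apply: H; split => // xy; apply: yx.
  by split=> -[m H']; exists m; apply/Hm.
Qed.

Lemma fo_free_bound f : exists b, forall x, fo_free x f -> (x < b)%N.
Proof.
elim: f => [|a b|R a|f IH|f [m Hm] g [p Hp]|f [m Hm] g [p Hp]|f [m Hm] g [p Hp]|x f [m Hm]|x f [m Hm]] /=.
- by exists 0.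
- by exists (maxn a b).+1 => x [<-|<-]; rewrite ltnS leq_max leqnn ?orbT.
- exists (\max_i a i).+1 => x [i <-]; rewrite ltnS; exact: (@leq_bigmax _ (fun j => a j) i).
- exact: IH.
- by exists (maxn m p) => x; rewrite leq_max => -[/Hm->|/Hp->]; rewrite ?orbT.
- by exists (maxn m p) => x; rewrite leq_max => -[/Hm->|/Hp->]; rewrite ?orbT.
- by exists (maxn m p) => x; rewrite leq_max => -[/Hm->|/Hp->]; rewrite ?orbT.
- by exists m => y [_ /Hm].
- by exists m => y [_ /Hm].
Qed.

Lemma sentence_eval f M (v w : nat -> M) :
  sentence f -> fo_eval v f <-> fo_eval w f.
Proof. by move=> sf; apply: fo_eval_ext => x /sf. Qed.

Lemma sentence_sat f M (v : nat -> M) : sentence f -> fo_sat M f <-> fo_eval v f.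
Proof. by move=> sf; split => [|H w]; [apply | apply/(sentence_eval _ v)]. Qed.

(** Bound variables are renamed as well, so an injective [s] causes no capture. *)
Fixpoint ren (s : nat -> nat) (f : form) : form :=
  match f with
  | FBot => FBot ar
  | FEq a b => FEq ar (s a) (s b)
  | FRel R a => FRel (fun i => s (a i))
  | FNeg g => FNeg (ren s g)
  | FAnd g h => FAnd (ren s g) (ren s h)
  | FOr g h => FOr (ren s g) (ren s h)
  | FImp g h => FImp (ren s g) (ren s h)
  | FAll x g => FAll (s x) (ren s g)
  | FEx x g => FEx (s x) (ren s g)
  end.

Lemma fo_eval_ren s f M (v : nat -> M) : injective s ->
  fo_eval v (ren s f) <-> fo_eval (v \o s) f.
Proof.
move=> si.
have updE x m w : upd w (s x) m \o s = upd (w \o s : nat -> M) x m.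
  by apply/funext => y; rewrite /upd /= (inj_eq si).
elim: f v => [|a b|R a|f IH|f IHf g IHg|f IHf g IHg|f IHf g IHg|x f IH|x f IH] v //=.
- by have := IH v; tauto.
- by have := IHf v; have := IHg v; tauto.
- by have := IHf v; have := IHg v; tauto.
- by have := IHf v; have := IHg v; tauto.
- by split => H m; have := H m; rewrite IH updE.
- by split => -[m H]; exists m; move: H; rewrite IH updE.
Qed.

Lemma fo_free_ren s f x : injective s ->
  fo_free x (ren s f) -> exists y, x = s y /\ fo_free y f.
Proof.
move=> si; elim: f => [|a b|R a|f IH|f IHf g IHg|f IHf g IHg|f IHf g IHg|z f IH|z f IH] //=.
- by move=> [<-|<-]; [exists a; auto | exists b; auto].
- by move=> [i <-]; exists (a i); split => //; exists i.
- by move=> [/IHf|/IHg] [y []]; exists y; auto.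
- by move=> [/IHf|/IHg] [y []]; exists y; auto.
- by move=> [/IHf|/IHg] [y []]; exists y; auto.
- by move=> [nx /IH[y [xy fy]]]; exists y; split => //; split => // zy; apply: nx; rewrite xy zy.
- by move=> [nx /IH[y [xy fy]]]; exists y; split => //; split => // zy; apply: nx; rewrite xy zy.
Qed.

Lemma qfree_ren s f : qfree f -> qfree (ren s f).
Proof. by elim: f => //= f IHf g IHg [/IHf ? /IHg]. Qed.

Scheme PiF_mut := Minimality for PiF Sort Prop
  with SigF_mut := Minimality for SigF Sort Prop.
Combined Scheme PiSigF_ind from PiF_mut, SigF_mut.

Lemma PiSigF_ren s : (forall n f, PiF n f -> PiF n (ren s f)) /\
  (forall n f, SigF n f -> SigF n (ren s f)).
Proof.
apply: (@PiSigF_ind sym ar (fun n f => PiF n (ren s f)) (fun n f => SigF n (ren s f))).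
- by move=> f /(qfree_ren s); constructor.
- by move=> n f _; constructor.
- by move=> n x f _; constructor.
- by move=> f /(qfree_ren s); constructor.
- by move=> n f _; constructor.
- by move=> n x f _; constructor.
Qed.

Lemma PiSigF_S : (forall n f, PiF n f -> PiF n.+1 f) /\ (forall n f, SigF n f -> SigF n.+1 f).
Proof.
apply: (@PiSigF_ind sym ar (fun n f => PiF n.+1 f) (fun n f => SigF n.+1 f)).
- by move=> f qf; constructor; constructor.
- by move=> n f _; constructor.
- by move=> n x f _; constructor.
- by move=> f qf; constructor; constructor.
- by move=> n f _; constructor.
- by move=> n x f _; constructor.
Qed.

Lemma PiF_qfree n f : qfree f -> PiF n f.
Proof. by move=> qf; elim: n => [|n IH]; [constructor | apply: PiSigF_S.1]. Qed.

Lemma SigF_qfree n f : qfree f -> SigF n f.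
Proof. by move=> qf; elim: n => [|n IH]; [constructor | apply: PiSigF_S.2]. Qed.

(** Prenex classes are closed under connectives only up to equivalence; the condition on free
    variables keeps sentences sentences and parameters parameters. *)
Definition neg_rep (C : set form) f := exists h,
  [/\ C h, forall x, fo_free x h -> fo_free x f
    & forall M (v : nat -> M), fo_eval v h <-> ~ fo_eval v f].

Lemma neg_PiSigF : (forall n f, PiF n f -> neg_rep (SigF n) f) /\
  (forall n f, SigF n f -> neg_rep (PiF n) f).
Proof.
apply: (@PiSigF_ind sym ar (fun n f => neg_rep (SigF n) f) (fun n f => neg_rep (PiF n) f)).
- by move=> f qf; exists (FNeg f); split => //; constructor.
- by move=> n f _ [h [Ch]]; exists h; split => //; constructor.
- move=> n x f _ [h [Ch fh eh]]; exists (FEx x h); split.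
  + by constructor.
  + by move=> y /= [yx /fh].
  + move=> M v /=; split; first by move=> [m /eh nf] H; apply: nf.
    by move=> /existsNP [m nf]; exists m; apply/eh.
- by move=> f qf; exists (FNeg f); split => //; constructor.
- by move=> n f _ [h [Ch]]; exists h; split => //; constructor.
- move=> n x f _ [h [Ch fh eh]]; exists (FAll x h); split.
  + by constructor.
  + by move=> y /= [yx /fh].
  + move=> M v /=; split; first by move=> H [m fm]; have /eh := H m; apply.
    by move=> H m; apply/eh => fm; apply: H; exists m.
Qed.

Definition conj_rep (C : set form) f g := exists h,
  [/\ C h, forall x, fo_free x h -> fo_free x f \/ fo_free x g
    & forall M (v : nat -> M), fo_eval v h <-> fo_eval v f /\ fo_eval v g].

Lemma conj_repC C f g : conj_rep C f g -> conj_rep C g f.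
Proof.
move=> [h [Ch fh eh]]; exists h; split => // [x /fh|M v]; first by tauto.
by rewrite eh; tauto.
Qed.

Definition swap (x z y : nat) := if y == x then z else if y == z then x else y.

Lemma swap_inj x z : injective (swap x z).
Proof.
apply: inv_inj => y; rewrite /swap.
case: (eqVneq y x) => [->|yx]; first by rewrite eqxx; case: eqVneq.
case: (eqVneq y z) => [->|yz]; first by rewrite eqxx.
by rewrite (negbTE yx) (negbTE yz).
Qed.

Lemma upd_swap M (v : nat -> M) x z m f : ~ fo_free z f ->
  fo_eval (upd v z m) (ren (swap x z) f) <-> fo_eval (upd v x m) f.
Proof.
move=> zf; rewrite fo_eval_ren; last exact: swap_inj.
apply: fo_eval_ext => y fy; rewrite /upd /= /swap.
case: (eqVneq y x) => [|yx]; first by rewrite eqxx.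
case: (eqVneq y z) => [yz|/negbTE-> //]; by rewrite yz in fy.
Qed.

Lemma conj_rep_FAll n x z f g : ~ fo_free z f -> ~ fo_free z g ->
  conj_rep (PiF n.+1) (ren (swap x z) f) g -> conj_rep (PiF n.+1) (FAll x f) g.
Proof.
move=> zf zg [h [Ch fh eh]]; exists (FAll z h); split.
- by constructor.
- move=> y /= [zy /fh[|]]; last by right.
  move=> /(fo_free_ren (@swap_inj x z)) [u [yu fu]]; left.
  move: yu; rewrite /swap; case: (eqVneq u x) => [_ /esym //|/eqP ux].
  case: (eqVneq u z) => [uz|_ ->]; first by rewrite uz in fu.
  by split => // /esym.
- move=> M v /=; have zg' m : fo_eval (upd v z m) g <-> fo_eval v g.
    apply: fo_eval_ext => y gy; rewrite /upd; case: eqVneq => // yz.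
    by rewrite yz in gy.
  split.
    (* The conjunct [g] comes out from under the quantifier because the universe is nonempty. *)
    move=> H; split; last by have /eh[_ /zg'] := H (v 0).
    by move=> m; have /eh[/upd_swap] := H m; auto.
  by move=> [H1 H2] m; apply/eh; split; [apply/upd_swap | apply/zg'].
Qed.

Lemma conj_rep_FEx n x z f g : ~ fo_free z f -> ~ fo_free z g ->
  conj_rep (SigF n.+1) (ren (swap x z) f) g -> conj_rep (SigF n.+1) (FEx x f) g.
Proof.
move=> zf zg [h [Ch fh eh]]; exists (FEx z h); split.
- by constructor.
- move=> y /= [zy /fh[|]]; last by right.
  move=> /(fo_free_ren (@swap_inj x z)) [u [yu fu]]; left.
  move: yu; rewrite /swap; case: (eqVneq u x) => [_ /esym //|/eqP ux].
  case: (eqVneq u z) => [uz|_ ->]; first by rewrite uz in fu.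
  by split => // /esym.
- move=> M v /=; have zg' m : fo_eval (upd v z m) g <-> fo_eval v g.
    apply: fo_eval_ext => y gy; rewrite /upd; case: eqVneq => // yz.
    by rewrite yz in gy.
  split; first by move=> [m /eh[/upd_swap-/(_ zf) H /zg']]; split => //; exists m.
  by move=> [[m H1] H2]; exists m; apply/eh; split; [apply/upd_swap | apply/zg'].
Qed.

Fixpoint nodes f : nat :=
  match f with
  | FBot | FEq _ _ | FRel _ _ => 0
  | FNeg g | FAll _ g | FEx _ g => (nodes g).+1
  | FAnd g h | FOr g h | FImp g h => (nodes g + nodes h).+1
  end.

Lemma nodes_ren s f : nodes (ren s f) = nodes f.
Proof. by elim: f => //= [f ->|f -> g ->|f -> g ->|f -> g ->|x f ->|x f ->]. Qed.

Lemma fresh2 f g : exists z, ~ fo_free z f /\ ~ fo_free z g.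
Proof.
have [b Hb] := fo_free_bound f; have [c Hc] := fo_free_bound g.
exists (maxn b c); split => [/Hb|/Hc]; by rewrite ltnNge ?leq_maxl ?leq_maxr.
Qed.

Lemma PiF_SP n f : PiF n.+1 f ->
  SigF n f \/ exists x g, f = FAll x g /\ PiF n.+1 g.
Proof. by move=> H; inversion H; subst; [left | right; exists x, f0]. Qed.

Lemma SigF_SP n f : SigF n.+1 f ->
  PiF n f \/ exists x g, f = FEx x g /\ SigF n.+1 g.
Proof. by move=> H; inversion H; subst; [left | right; exists x, f0]. Qed.

(** Leading quantifiers are pulled out, with fresh names, from one conjunct and then the other until
    both lie one class lower. Renaming rules out structural recursion, hence the inner induction on
    [nodes], which [ren] preserves. *)
Lemma conj_PiSigF n :
  (forall f g, PiF n f -> PiF n g -> conj_rep (PiF n) f g) /\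
  (forall f g, SigF n f -> SigF n g -> conj_rep (SigF n) f g).
Proof.
elim: n => [|n [IHP IHS]].
  split => f g Hf Hg; exists (FAnd f g); split => //; constructor; split;
    by [inversion Hf | inversion Hg].
split=> f g.
- have [m] := ubnP (nodes f + nodes g); elim: m f g => // m IH f g le_m.
  move=> /PiF_SP[Sf|[x [f' [fE Pf]]]] Pg.
    move: (Pg) => /PiF_SP[Sg|[x [g' [gE Pg']]]].
      have [h [Ch fh eh]] := IHS f g Sf Sg.
      by exists h; split => //; constructor.
    subst g; have [z [zg zf]] := fresh2 g' f.
    apply/conj_repC/(conj_rep_FAll zg zf)/conj_repC/IH.
    + by move: le_m => /=; rewrite nodes_ren addnS.
    + by constructor.
    + exact: (PiSigF_ren _).1.
  subst f; have [z [zf zg]] := fresh2 f' g.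
  apply/(conj_rep_FAll zf zg)/IH => //; first by rewrite nodes_ren.
  exact: (PiSigF_ren _).1.
- have [m] := ubnP (nodes f + nodes g); elim: m f g => // m IH f g le_m.
  move=> /SigF_SP[Sf|[x [f' [fE Pf]]]] Pg.
    move: (Pg) => /SigF_SP[Sg|[x [g' [gE Pg']]]].
      have [h [Ch fh eh]] := IHP f g Sf Sg.
      by exists h; split => //; constructor.
    subst g; have [z [zg zf]] := fresh2 g' f.
    apply/conj_repC/(conj_rep_FEx zg zf)/conj_repC/IH.
    + by move: le_m => /=; rewrite nodes_ren addnS.
    + by constructor.
    + exact: (PiSigF_ren _).2.
  subst f; have [z [zf zg]] := fresh2 f' g.
  apply/(conj_rep_FEx zf zg)/IH => //; first by rewrite nodes_ren.
  exact: (PiSigF_ren _).2.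
Qed.

Lemma conj_finite (C : set form) (S : set nat) (phi : nat -> form) j :
  (forall f g, C f -> C g -> conj_rep C f g) -> C (FNeg (FBot ar)) ->
  (forall i, C (phi i)) -> (forall i x, fo_free x (phi i) -> S x) ->
  exists h, [/\ C h, forall x, fo_free x h -> S x
    & forall M (v : nat -> M), fo_eval v h <-> forall i, (i < j)%N -> fo_eval v (phi i)].
Proof.
move=> CC C0 Cphi Sphi; elim: j => [|j [h [Ch Sh eh]]].
  by exists (FNeg (FBot ar)); split => //= M v; split => // _ [].
have [g [Cg Sg eg]] := CC _ _ Ch (Cphi j).
exists g; split => // [x /Sg[/Sh|/Sphi] //|M v]; rewrite eg eh.
split => [[H1 H2] i|H]; last by split => [i ij|]; apply: H; rewrite // ltnW.
by rewrite ltnS leq_eqVlt => /orP[/eqP->|/H1].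
Qed.

(** Closes [h] existentially over the variables from [l] on, phrased with whole assignments to match
    the form of saturation. *)
Lemma ex_block k h l m : PiF k h -> (forall x, fo_free x h -> (x < l + m)%N) ->
  exists E, [/\ SigF k.+1 E, forall x, fo_free x E -> (x < l)%N
    & forall M (v : nat -> M), fo_eval v E <->
        exists w : nat -> M, (forall x, (x < l)%N -> w x = v x) /\ fo_eval w h].
Proof.
move=> Ph; elim: m l => [|m IH] l Hh.
  rewrite addn0 in Hh; exists h; split => // [|M v]; first by constructor.
  split => [H|[w [wv]]]; first by exists v.
  by apply: (fo_eval_ext _).1 => x /Hh /wv.
have [|E [SE fE eE]] := IH l.+1; first by rewrite addSnnS.
exists (FEx l E); split => [|x /= [xl /fE]|M v /=]; first by constructor.
  by rewrite ltnS leq_eqVlt => /orP[/eqP xl'|//]; case: xl.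
split=> [[m0 /eE [w [wv wh]]]|[w [wv wh]]].
  exists w; split => // x xl; rewrite wv 1?ltnW // /upd; case: eqVneq => // xl'.
  by rewrite xl' ltnn in xl.
exists (w l); apply/eE; exists w; split => // x; rewrite ltnS leq_eqVlt /upd.
by case: eqVneq => [->|_ /= /wv].
Qed.

(** Trees with countable labels show that formulas can be enumerated; the arguments of an atom are
    stored as a finite function, which has a countable type. *)
Fixpoint enc_form f : GenTree.tree (nat + fact ar) :=
  match f with
  | FBot => GenTree.Node 0 [::]
  | FEq a b => GenTree.Node 1 [:: GenTree.Leaf (inl a); GenTree.Leaf (inl b)]
  | FRel R a => GenTree.Leaf (inr (Tagged (fun R => {ffun 'I_(ar R) -> nat}) [ffun i => a i]))
  | FNeg g => GenTree.Node 2 [:: enc_form g]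
  | FAnd g h => GenTree.Node 3 [:: enc_form g; enc_form h]
  | FOr g h => GenTree.Node 4 [:: enc_form g; enc_form h]
  | FImp g h => GenTree.Node 5 [:: enc_form g; enc_form h]
  | FAll x g => GenTree.Node 6 [:: GenTree.Leaf (inl x); enc_form g]
  | FEx x g => GenTree.Node 7 [:: GenTree.Leaf (inl x); enc_form g]
  end.

Fixpoint dec_form (t : GenTree.tree (nat + fact ar)) : form :=
  match t with
  | GenTree.Node 1 [:: GenTree.Leaf (inl a); GenTree.Leaf (inl b)] => FEq ar a b
  | GenTree.Leaf (inr c) => @FRel _ _ (tag c) (fun i => tagged c i)
  | GenTree.Node 2 [:: g] => FNeg (dec_form g)
  | GenTree.Node 3 [:: g; h] => FAnd (dec_form g) (dec_form h)
  | GenTree.Node 4 [:: g; h] => FOr (dec_form g) (dec_form h)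
  | GenTree.Node 5 [:: g; h] => FImp (dec_form g) (dec_form h)
  | GenTree.Node 6 [:: GenTree.Leaf (inl x); g] => FAll x (dec_form g)
  | GenTree.Node 7 [:: GenTree.Leaf (inl x); g] => FEx x (dec_form g)
  | _ => FBot ar
  end.

Lemma enc_formK : cancel enc_form dec_form.
Proof.
elim=> //= [R a|f ->|f -> g ->|f -> g ->|f -> g ->|x f ->|x f ->] //.
by congr FRel; apply/funext => i; rewrite ffunE.
Qed.

Definition nth_form (e : nat) : form :=
  if unpickle e is Some t then dec_form t else FBot ar.

Lemma nth_form_surj f : exists e, nth_form e = f.
Proof. by exists (pickle (enc_form f)); rewrite /nth_form pickleK enc_formK. Qed.

End Formulas.

(** * Ultraproducts and saturation *)

Lemma choice_dep (I : Type) (X : I -> Type) (P : forall i, X i -> Prop) :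
  (forall i, exists x, P i x) -> exists f : forall i, X i, forall i, P i (f i).
Proof. by move=> H; exists (fun i => projT1 (cid (H i))) => i; case: cid. Qed.

Section Ultraproduct.
Variables (sym : countType) (ar : sym -> nat) (M : nat -> structure ar).
Variables (U : set_system nat) (UU : UltraFilter U) (Uoo : \oo `<=` U).
Notation form := (fo_form ar).

#[local] Instance ultra_is_proper : ProperFilter U. Proof. exact: ultra_proper. Qed.

Definition raw := forall i, M i.
Definition eqv (f g : raw) : Prop := U [set i | f i = g i].
Definition ucarrier := {P : set raw | exists f, P = eqv f}.
Definition ucls (f : raw) : ucarrier := exist _ (eqv f) (ex_intro _ f erefl).
Definition urepr (c : ucarrier) : raw := projT1 (cid (proj2_sig c)).

Lemma eqv_refl f : eqv f f.
Proof. by apply: filterS filterT => i. Qed.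

Lemma eqv_sym f g : eqv f g -> eqv g f.
Proof. by apply: filterS => i /= ->. Qed.

Lemma eqv_trans f g h : eqv f g -> eqv g h -> eqv f h.
Proof. by move=> H1 H2; apply: filterS (filterI H1 H2) => i /= [-> ->]. Qed.

Lemma uclsE f g : ucls f = ucls g <-> eqv f g.
Proof.
split => [/(congr1 (@proj1_sig _ _)) /= ->|fg]; first exact: eqv_refl.
apply: eq_sig_hprop => [? ? ?|/=]; first exact: Prop_irrelevance.
apply/seteqP; split => h; first exact/eqv_trans/eqv_sym.
exact: eqv_trans.
Qed.

Lemma ureprK c : ucls (urepr c) = c.
Proof.
apply: eq_sig_hprop => [? ? ?|/=]; first exact: Prop_irrelevance.
by rewrite /urepr; case: cid => f /= ->.
Qed.

Definition uprod : structure ar :=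
  @Structure _ ar ucarrier (ucls (fun i => elt0 (M i)))
    (fun R a => U [set i | interp (fun j => urepr (a j) i)]).

Lemma ultra_not (A : set nat) : U (~` A) <-> ~ U A.
Proof.
split => [H1 H2|H]; last by case: (in_ultra_setVsetC A UU).
by apply: (@filter_not_empty _ U); rewrite -(setICr A); exact: filterI.
Qed.

Lemma ultra_and (A B : set nat) : U (A `&` B) <-> U A /\ U B.
Proof.
split => [H|[HA HB]]; last exact: filterI.
by split; apply: filterS H => x [].
Qed.

Lemma ultra_or (A B : set nat) : U (A `|` B) <-> U A \/ U B.
Proof.
split=> [H|[] H]; [|by apply: filterS H; left|by apply: filterS H; right].
apply: contrapT => /not_orP[/ultra_not nA /ultra_not nB].
apply: (@filter_not_empty _ U); apply: filterS (filterI H (filterI nA nB)) => x /=.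
by case=> -[] ? [].
Qed.

Lemma ultra_forall (I : finType) (F : I -> set nat) :
  (forall j, U (F j)) -> U [set i | forall j, F j i].
Proof. exact: filter_forall. Qed.

(** The step of Los's theorem that needs choice: a witness is picked in each factor, with a default
    where there is none. Universal quantifiers reduce to it by negation. *)
Lemma los_ex x (f : form) (w : nat -> raw) :
  (forall w : nat -> raw, @fo_eval _ _ uprod (fun y => ucls (w y)) f <->
     U [set i | fo_eval (fun y => w y i) f]) ->
  (exists m : uprod, fo_eval (upd (fun y => ucls (w y) : uprod) x m) f) <->
  U [set i | exists m : M i, fo_eval (upd (fun y => w y i) x m) f].
Proof.
move=> IH.
have updc (g : raw) : upd (fun y => ucls (w y) : uprod) x (ucls g) = fun y => ucls (upd w x g y).
  by apply/funext => y; rewrite /upd; case: ifP.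
have updr (g : raw) i : (fun y => upd w x g y i) = upd (fun y => w y i) x (g i).
  by apply/funext => y; rewrite /upd; case: ifP.
split=> [[m]|H].
  rewrite -(ureprK m) updc IH; apply: filterS => i /=.
  by rewrite updr; exists (urepr m i).
have /choice_dep [g Hg] : forall i, exists m : M i,
    (exists m : M i, fo_eval (upd (fun y => w y i) x m) f) ->
    fo_eval (upd (fun y => w y i) x m) f.
  move=> i; have [[m Hm]|nH] := pselect (exists m : M i, fo_eval (upd (fun y => w y i) x m) f).
    by exists m.
  by exists (elt0 (M i)).
exists (ucls g); rewrite updc IH; apply: filterS H => i /= /Hg.
by rewrite updr.
Qed.

Lemma los (f : form) (w : nat -> raw) :
  @fo_eval _ _ uprod (fun x => ucls (w x)) f <-> U [set i | fo_eval (fun x => w x i) f].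
Proof.
elim: f w => [|a b|R a|f IH|f IHf g IHg|f IHf g IHg|f IHf g IHg|x f IH|x f IH] w /=.
- by split => // /filter_not_empty.
- exact: uclsE.
- have E : U [set i | forall j, urepr (ucls (w (a j))) i = w (a j) i].
    apply: (@ultra_forall _ (fun j i => urepr (ucls (w (a j))) i = w (a j) i)) => j.
    by apply/uclsE; rewrite ureprK.
  split => H; apply: filterS (filterI H E) => i /= [+ Ei].
    by have -> : (fun j => urepr (ucls (w (a j))) i) = fun j => w (a j) i by apply/funext.
  by have -> : (fun j => urepr (ucls (w (a j))) i) = fun j => w (a j) i by apply/funext.
- by rewrite IH -ultra_not.
- by rewrite IHf IHg -ultra_and.
- by rewrite IHf IHg -ultra_or.
- rewrite IHf IHg; have -> : [set i | fo_eval (fun x => w x i) f -> fo_eval (fun x => w x i) g]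
     = ~` [set i | fo_eval (fun x => w x i) f] `|` [set i | fo_eval (fun x => w x i) g].
    by rewrite predeqE => i /=; rewrite implyE.
  by rewrite ultra_or ultra_not implyE.
- have := @los_ex x (FNeg f) w; move=> /= H.
  have {}H : (exists m : uprod, ~ fo_eval (upd (fun y => ucls (w y) : uprod) x m) f) <->
    U [set i | exists m : M i, ~ fo_eval (upd (fun y => w y i) x m) f].
    by apply: H => w'; rewrite IH -ultra_not.
  have -> : [set i | forall m : M i, fo_eval (upd (fun y => w y i) x m) f] =
     ~` [set i | exists m : M i, ~ fo_eval (upd (fun y => w y i) x m) f].
    apply/seteqP; split => i /=; first by move=> Hi [m]; apply.
    by move=> Hi m; apply: contrapT => Hm; apply: Hi; exists m.
  rewrite ultra_not -H; split; first by move=> Hi [m]; apply.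
  by move=> Hi m; apply: contrapT => Hm; apply: Hi; exists m.
- exact: los_ex.
Qed.

Lemma uprod_eval (f : form) (v : nat -> uprod) :
  fo_eval v f <-> U [set i | fo_eval (fun x => urepr (v x) i) f].
Proof.
by rewrite -(los f (fun x => urepr (v x))) (_ : (fun x => _) = v) //;
  apply/funext => x; rewrite ureprK.
Qed.

Lemma uprod_sat (f : form) : sentence f ->
  fo_sat uprod f <-> U [set i | fo_sat (M i) f].
Proof.
move=> sf; pose w (x : nat) : raw := fun i => elt0 (M i).
rewrite (sentence_sat (fun x => ucls (w x) : uprod) sf) los.
by split; apply: filterS => i /=; rewrite (sentence_sat (fun x => w x i) sf).
Qed.

Lemma uprod_infinite : (forall i, infinite_structure (M i)) -> infinite_structure uprod.
Proof.
move=> /choice_dep[g Hg]; exists (fun k => ucls (fun i => g i k)) => k l /uclsE H.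
have [i /= Hi] := filter_ex H; exact: (Hg i).
Qed.

(* Saturation for countable sets of formulas, in infinitely many unknowns at
   once: the variables in [S] are parameters, the others are to be realized. *)
Definition saturated (A : structure ar) := forall (S : set nat) (phi : nat -> form) (v : nat -> A),
  (forall j, exists w : nat -> A, (forall x, S x -> w x = v x) /\
     forall i, (i < j)%N -> fo_eval w (phi i)) ->
  exists w : nat -> A, (forall x, S x -> w x = v x) /\ forall i, fo_eval w (phi i).

(** In factor [i], realize the longest initial piece of [phi] of length at most [i] that is
    satisfiable there. Each formula then holds on a set in [U], because [U] contains the cofinite
    sets. *)
Lemma uprod_saturated : saturated uprod.
Proof.
move=> S phi v H.
pose P i j := exists w : nat -> M i, (forall x, S x -> w x = urepr (v x) i) /\
     forall l, (l < j)%N -> fo_eval w (phi l).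
have Hw i : exists w : nat -> M i, (forall x, S x -> w x = urepr (v x) i) /\
    forall j, (j <= i)%N -> P i j -> forall l, (l < j)%N -> fo_eval w (phi l).
  suff /(_ i) : forall b, exists w : nat -> M i, (forall x, S x -> w x = urepr (v x) i) /\
    forall j, (j <= b)%N -> P i j -> forall l, (l < j)%N -> fo_eval w (phi l) by [].
  elim=> [|b [w [wS wP]]].
    by exists (fun x => urepr (v x) i); split => // j; rewrite leqn0 => /eqP->.
  have [[w' [w'S w'P]]|nP] := pselect (P i b.+1).
    by exists w'; split => // j jb _ l lj; apply: w'P; exact: leq_trans lj jb.
  exists w; split => // j; rewrite leq_eqVlt => /orP[/eqP-> //|]; exact: wP.
move: Hw => /choice_dep[w Hw].
exists (fun x => ucls (fun i => w i x)); split.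
  move=> x Sx; rewrite -[RHS]ureprK; congr ucls; apply: functional_extensionality_dep => i.
  exact: (Hw i).1.
move=> l; apply/(los (phi l) (fun x i => w i x)).
have [w' [w'S w'P]] := H l.+1.
have UP : U [set i | P i l.+1].
  have : U [set i | forall j : 'I_l.+1, fo_eval (fun x => urepr (w' x) i) (phi j)].
    apply: (@ultra_forall _ (fun (j : 'I_l.+1) i => fo_eval (fun x => urepr (w' x) i) (phi j))) => j.
    exact/uprod_eval/w'P.
  apply: filterS => i Hi; exists (fun x => urepr (w' x) i); split.
    by move=> x Sx; rewrite w'S.
  by move=> j jl; exact: (Hi (Ordinal jl)).
have Ul : U [set i | (l < i)%N] by apply: Uoo; exact: nbhs_infty_gt.
by apply: filterS (filterI UP Ul) => i /= [Pi li]; apply: (Hw i).2 Pi _ _.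
Qed.

End Ultraproduct.

(** * Positions in a pair of structures *)

Section Models.
Variables (sym : countType) (ar : sym -> nat).
Notation form := (fo_form ar).

(* [M] is an ultrapower of a model of the forall_n-consequences of [T], and [N] an
   ultraproduct of models of [T] satisfying more and more of its exists_n-theory. *)
Lemma model_pair (T : set form) n :
  (forall f, T f -> sentence f) -> ~ has_forall_axiomatization T n ->
  exists M N : structure ar,
    [/\ saturated M /\ saturated N, infinite_structure M /\ infinite_structure N,
        forall g, T g -> fo_sat N g, exists2 g, T g & ~ fo_sat M g
      & forall f, sentence f -> PiF n f -> fo_sat N f -> fo_sat M f].
Proof.
move=> Ts nax; pose Ax : set form := [set f | conseq T f /\ PiF n f].
have [f [Tf nAf]] : exists f, conseq T f /\ ~ conseq Ax f.
  apply: contrapT => H; apply: nax; exists Ax; split; first by move=> f [[]].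
  move=> f; split; last by move=> Tf; apply: contrapT => nA; apply: H; exists f.
  move=> [sf Hf]; split => // M Minf MT; apply: Hf => // g [[sg Hg] _]; exact: Hg.
have [M [Minf MAx nMf]] : exists M : structure ar,
    [/\ infinite_structure M, forall g, Ax g -> fo_sat M g & ~ fo_sat M f].
  apply: contrapT => H; apply: nAf; split; first by case: Tf.
  by move=> M Minf MA; apply: contrapT => nM; apply: H; exists M.
have [g0 Tg0 nMg0] : exists2 g, T g & ~ fo_sat M g.
  apply: contrapT => H; apply: nMf; apply: Tf.2 => // g Tg.
  by apply: contrapT => nM; apply: H; exists g.
(* [phi] enumerates the exists_n-theory of M, padded with a true sentence. *)
pose phi i := if `[< [/\ sentence (nth_form ar i), SigF n (nth_form ar i)
    & fo_sat M (nth_form ar i)] >] then nth_form ar i else FNeg (FBot ar).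
have phiP i : [/\ sentence (phi i), SigF n (phi i) & fo_sat M (phi i)].
  rewrite /phi; case: asboolP => // _; split => //; [by move=> x [] | exact: SigF_qfree | by move=> v []].
have phis i x : fo_free x (phi i) -> set0 x by case: (phiP i) => H _ _ /H.
have phiS i : SigF n (phi i) by case: (phiP i).
(* Otherwise the negated conjunction of the first [j] of these sentences would be a
   forall_n-consequence of [T], hence true in M. *)
have /choice[N HN] : forall j, exists N : structure ar, [/\ infinite_structure N,
    forall g, T g -> fo_sat N g & forall i, (i < j)%N -> fo_sat N (phi i)].
  move=> j; apply: contrapT => noN.
  have [h [Sh fh eh]] := @conj_finite _ _ (SigF n) set0 phi j
    (conj_PiSigF ar n).2 (SigF_qfree n (f := FNeg (FBot ar)) I)
    phiS phis.
  have [h' [Ph' fh' eh']] := (neg_PiSigF ar).2 n h Sh.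
  have sh' : sentence h' by move=> x /fh' /fh.
  have : fo_sat M h'.
    apply: MAx; split => //; split => // N Ninf NT.
    apply/(sentence_sat (fun=> elt0 N) sh'); rewrite eh' eh => H.
    apply: noN; exists N; split => // i ij; have [si _ _] := phiP i.
    exact/(sentence_sat (fun=> elt0 N) si)/H.
  move=> /(_ (fun=> elt0 M)); rewrite eh' eh; apply => i _.
  by have [_ _] := phiP i; apply.
have [U [UU Uoo]] := ultraFilterLemma eventually_filter.
exists (uprod (fun=> M) U), (uprod N U); split.
- by split; apply: uprod_saturated.
- by split; apply: uprod_infinite => // i; case: (HN i).
- move=> g Tg; apply/uprod_sat => //; first exact: Ts.
  have FU : ProperFilter U by exact: ultra_proper.
  by apply: filterS filterT => i _; case: (HN i) => _ /(_ g Tg).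
- exists g0 => //; rewrite uprod_sat; last exact: Ts.
  have FU : ProperFilter U by exact: ultra_proper.
  by move=> /filter_ex[].
- move=> f' sf' Pf'; rewrite !uprod_sat // => HU.
  have FU : ProperFilter U by exact: ultra_proper.
  apply: filterS filterT => _ _ /=; apply: contrapT => nM.
  have [h [Sh fh eh]] := (neg_PiSigF ar).1 n f' Pf'.
  have sh : sentence h by move=> x /fh /sf'.
  have [e eE] := nth_form_surj h.
  have phie : phi e = h.
    rewrite /phi; case: asboolP => //; rewrite eE; case; split => //.
    apply/(sentence_sat (fun=> elt0 M) sh); rewrite eh => H; apply: nM.
    exact/(sentence_sat _ sf')/H.
  have Ue : U [set i | (e < i)%N] by apply: Uoo; exact: nbhs_infty_gt.
  have [i [/= Ni ei]] := filter_ex (filterI HU Ue).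
  have [_ _ /(_ e ei)] := HN i; rewrite phie => /(_ (fun=> elt0 (N i))).
  by rewrite eh; apply; exact: Ni.
Qed.

End Models.

(** * Finite tuples, their types, and one step of the construction *)

Section Positions.
Variables (sym : countType) (ar : sym -> nat) (St : bool -> structure ar).
Notation form := (fo_form ar).

Definition pos := {c : bool & seq (St c)}.
Definition mkpos c (s : seq (St c)) : pos := Tagged (fun c => seq (St c)) s.
Implicit Types p q r : pos.

Definition psize p := size (tagged p).
Definition pval p : nat -> St (tag p) := nth (elt0 (St (tag p))) (tagged p).

(* [p] and [q] may lie in different structures. *)
Definition ext k p q := (psize p <= psize q)%N /\
  forall f, PiF k f -> (forall x, fo_free x f -> (x < psize p)%N) ->
    fo_eval (pval p) f -> fo_eval (pval q) f.

Definition prolong p q := exists d, q = mkpos (tagged p ++ d).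

Definition distinct_pos p := forall i j, (i < psize p)%N -> (j < psize p)%N ->
  pval p i = pval p j -> i = j.

Lemma ext_refl k p : ext k p p. Proof. by []. Qed.

Lemma ext_trans k p q r : ext k p q -> ext k q r -> ext k p r.
Proof.
move=> [s1 H1] [s2 H2]; split; first exact: leq_trans s1 s2.
by move=> f Pf fp /(H1 _ Pf fp); apply: H2 => // x /fp xp; exact: leq_trans xp s1.
Qed.

Lemma extS k p q : ext k.+1 p q -> ext k p q.
Proof. by move=> [s H]; split => // f /(PiSigF_S ar).1; exact: H. Qed.

Lemma ext_le j k p q : (j <= k)%N -> ext k p q -> ext j p q.
Proof.
move=> /subnK <-; elim: (k - j)%N => // m IH; rewrite addSn => /extS; exact: IH.
Qed.

Lemma prolong_refl p : prolong p p.
Proof. by exists [::]; rewrite cats0; case: p. Qed.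

Lemma prolong_trans p q r : prolong p q -> prolong q r -> prolong p r.
Proof. by move=> [d ->] [d' ->]; exists (d ++ d'); rewrite catA. Qed.

Lemma prolong_tag p q : prolong p q -> tag q = tag p.
Proof. by move=> [d ->]. Qed.

Lemma prolong_size p q : prolong p q -> (psize p <= psize q)%N.
Proof. by move=> [d ->]; rewrite /psize size_cat leq_addr. Qed.

Lemma prolong_eval p q w (f : form) : prolong p q ->
  (forall x, fo_free x f -> (w x < psize p)%N) ->
  fo_eval (fun x => pval p (w x)) f <-> fo_eval (fun x => pval q (w x)) f.
Proof.
move=> [d ->] fp; apply: fo_eval_ext => x /fp wx.
by rewrite /pval /= nth_cat -/(psize p) wx.
Qed.

Lemma prolong_ext k p q : prolong p q -> ext k p q.
Proof.
move=> pq; split => [|f _ fp]; first exact: prolong_size.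
by move/(prolong_eval (w := id) pq fp).
Qed.

Lemma ext0_distinct p q : ext 0 p q -> psize q = psize p -> distinct_pos p -> distinct_pos q.
Proof.
move=> [_ H] sz dp i j; rewrite sz => ip jp qij; apply: dp => //.
apply: contrapT => nij; apply: (H (FNeg (FEq ar i j))) qij => //.
  by constructor.
by move=> x /= [<-|<-].
Qed.

(** If a finite part of the forall_k-type of [q] were not realizable over [p], this failure would be
    a forall_{k+1}-statement true of [p], hence of [q], which is absurd. Saturation then realizes
    the whole type in the structure of [p]. *)
Lemma lift_pos k p q : saturated (St (tag p)) -> ext k.+1 p q ->
  exists r, [/\ prolong p r, ext k q r & psize r = psize q].
Proof.
move=> sat [spq Hpq].
pose phi e := if `[< [/\ PiF k (nth_form ar e),
    forall x, fo_free x (nth_form ar e) -> (x < psize q)%N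
  & fo_eval (pval q) (nth_form ar e)] >] then nth_form ar e else FNeg (FBot ar).
have phiP e : [/\ PiF k (phi e), forall x, fo_free x (phi e) -> (x < psize q)%N
    & fo_eval (pval q) (phi e)].
  by rewrite /phi; case: asboolP => // _; split => //; exact: PiF_qfree.
have phiP1 i : PiF k (phi i) by case: (phiP i).
have phiP2 i x : fo_free x (phi i) -> (x < psize q)%N by case: (phiP i) => _ H _ /H.
have [j|w [wS wphi]] := sat [set x | (x < psize p)%N] phi (pval p).
  have [h [Ph fh eh]] := @conj_finite _ _ (PiF k) [set x | (x < psize q)%N] phi j
    (conj_PiSigF ar k).1 (PiF_qfree k (f := FNeg (FBot ar)) I)
    phiP1 phiP2.
  have [|E [SE fE eE]] := @ex_block _ _ k h (psize p) (psize q - psize p) Ph.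
    by rewrite subnKC.
  have [w [wv /eh wh]] : exists w, (forall x, (x < psize p)%N -> w x = pval p x) /\ fo_eval w h.
    apply/eE; apply: contrapT => nE.
    have [E' [PE' fE' eE']] := (neg_PiSigF ar).2 _ _ SE.
    have /eE' : fo_eval (pval q) E' by apply: Hpq => // [x /fE' /fE //|]; exact/eE'.
    apply; apply/eE; exists (pval q); split => //.
    by apply/eh => i _; have [] := phiP i.
  by exists w.
pose r := mkpos (tagged p ++ [seq w (psize p + i)%N | i <- iota 0 (psize q - psize p)]).
have sr : psize r = psize q.
  by rewrite /psize /= size_cat size_map size_iota subnKC.
have rw x : (x < psize q)%N -> pval r x = w x.
  move=> xq; rewrite /pval /= nth_cat -/(psize p); case: ltnP => xp.
    by rewrite wS.
  rewrite (nth_map 0) ?size_iota; last by rewrite ltn_sub2r // (leq_ltn_trans xp xq).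
  by rewrite nth_iota ?add0n ?subnKC // ltn_sub2r // (leq_ltn_trans xp xq).
exists r; split => //; first by eexists.
split; first by rewrite sr.
move=> f Pf fq qf; have [e eE] := nth_form_surj f.
have phie : phi e = f by rewrite /phi; case: asboolP => //; rewrite eE; case; split.
by have := wphi e; rewrite phie; apply: (fo_eval_ext _).1 => x /fq /rw.
Qed.

(** Lift step by step from [p 0] to [p n]. The lift from [p k] to [p k.+1] still preserves
    forall_k-types, so what holds at lower levels survives; it keeps the length, and negated
    equations keep the entries distinct. *)
Lemma chain_pos n (p : nat -> pos) : (forall c, saturated (St c)) ->
  (forall k, (k < n)%N -> ext k.+1 (p k.+1) (p k)) -> distinct_pos (p 0) ->
  exists r, [/\ prolong (p n) r, forall k, (k <= n)%N -> ext k (p k) r & distinct_pos r].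
Proof.
move=> sat; elim: n => [|n IH] Hp d0.
  exists (p 0); split => // [|k]; first exact: prolong_refl.
  by rewrite leqn0 => /eqP->; exact: ext_refl.
have [r [pr rk dr]] := IH (fun k kn => Hp k (leqW kn)) d0.
have [|r' [pr' rr' sr']] := @lift_pos n (p n.+1) r (sat _).
  exact: ext_trans (Hp n (ltnSn n)) (prolong_ext _ pr).
exists r'; split => // [k|]; last by apply: ext0_distinct sr' dr; exact: ext_le rr'.
rewrite leq_eqVlt => /orP[/eqP->|kn]; first exact: prolong_ext.
by apply: ext_trans (rk k kn) _; exact: ext_le rr'.
Qed.

(* The e-th instance "exists x, g" at the elements with indices [w] that a
   Tarski-Vaught construction has to take care of. *)
Definition req (e : nat) : form * nat * seq nat :=
  if @unpickle (nat * nat * seq nat)%type e is Some (a, x, w) then (nth_form ar a, x, w)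
  else (FBot ar, 0, [::]).

Definition witnessed m p q := forall e, (e < m)%N ->
  let: (g, x, w) := req e in
  (forall y, (nth 0 w y < psize p)%N) ->
  (exists d, fo_eval (upd (fun y => pval p (nth 0 w y)) x d) g) ->
  exists i, (i < psize q)%N /\ fo_eval (fun y => pval q (upd (nth 0 w) x i y)) g.

Lemma witnessed_prolong m p q r : prolong p q -> witnessed m q r -> witnessed m p r.
Proof.
move=> pq wr e em; have := wr e em; case: (req e) => [[g x] w] H ws [d Hd].
apply: H => [y|]; first exact: leq_trans (ws y) (prolong_size pq).
case: pq => d' ->; exists d; move: Hd.
apply: (fo_eval_ext _).1 => y _; rewrite /upd; case: eqVneq => // _.
by rewrite /pval /= nth_cat -/(psize p) ws.
Qed.

Lemma uniq_adjoin (X : eqType) (s : seq X) (D : seq X) : uniq s ->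
  exists d, uniq (s ++ d) /\ {subset D <= s ++ d}.
Proof.
move=> us; exists [seq x <- undup D | x \notin s]; split.
  rewrite cat_uniq us filter_uniq ?undup_uniq // andbT.
  by apply/hasPn => x; rewrite mem_filter => /andP[].
move=> x xD; rewrite mem_cat mem_filter mem_undup xD andbT.
by case: (x \in s).
Qed.

Lemma fresh_elt (X : eqType) (g : nat -> X) (s : seq X) : injective g ->
  exists x, x \notin s.
Proof.
move=> gi; apply: contrapT => H.
have : (size [seq g i | i <- iota 0 (size s).+1] <= size s)%N.
  apply: uniq_leq_size; first by rewrite map_inj_uniq ?iota_uniq.
  by move=> x _; apply: contrapT => /negP xs; apply: H; exists x.
by rewrite size_map size_iota ltnn.
Qed.

(** Adjoin the missing witnesses for the first [m] requests without repetition, and one element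
    outside [p] to make the length grow. *)
Lemma grow_pos m p : infinite_structure (St (tag p)) -> distinct_pos p ->
  exists q, [/\ prolong p q, distinct_pos q, (psize p < psize q)%N & witnessed m p q].
Proof.
case: p => c s /= [g gi] ds.
pose X : eqType := {classic St c}.
have us : uniq (s : seq X) by apply/(uniqP (elt0 (St c) : X)) => i j ip jp; exact: ds.
have [x0 x0s] := @fresh_elt X g s gi.
have /choice[D HD] : forall e, exists d : St c, let: (g, x, w) := req e in
   (exists d, fo_eval (upd (fun y => pval (mkpos s) (nth 0 w y)) x d) g) ->
   fo_eval (upd (fun y => pval (mkpos s) (nth 0 w y)) x d) g.
  move=> e; case: (req e) => [[h x] w].
  have [[d Hd]|nH] := pselect (exists d, fo_eval (upd (fun y => pval (mkpos s) (nth 0 w y)) x d) h).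
    by exists d.
  by exists (elt0 (St c)).
have [d [ud Dd]] := @uniq_adjoin X s (x0 :: [seq D e | e <- iota 0 m]) us.
exists (mkpos (s ++ d : seq (St c))); split; first by exists d.
- move=> i j ip jp; exact: (uniqP (elt0 (St c) : X) ud).
- rewrite /psize /= size_cat -[X in (X < _)%N]addn0 ltn_add2l lt0n.
  apply/negP => /eqP/size0nil d0; move: (Dd x0 (mem_head _ _)).
  by rewrite d0 cats0 (negbTE x0s).
move=> e em; have := HD e; case: (req e) => [[h x] w] He ws /He {He}.
have : (D e : X) \in (s : seq X) ++ d.
  by apply: Dd; rewrite inE; apply/orP; right; apply: map_f; rewrite mem_iota.
move=> /(nthP (elt0 (St c) : X))[i ilt iE] He; exists i; split => //.
move: He; apply: (fo_eval_ext _).1 => y _; rewrite /upd /pval /=.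
case: eqVneq => _; first exact/esym.
by rewrite nth_cat; have := ws y; rewrite /psize /= => ->.
Qed.

(** [p k] stands for the tuple at the last earlier stage that looks true at level [k], and [c] for
    the structure wanted now. The condition on tags permits a switch only from [St false] to
    [St true]. *)
Lemma next_pos n m c (p : nat -> pos) :
  (forall c, saturated (St c)) -> (forall c, infinite_structure (St c)) ->
  (forall f, sentence f -> PiF n.+1 f -> fo_sat (St true) f -> fo_sat (St false) f) ->
  (forall k, (k < n)%N -> ext k.+1 (p k.+1) (p k)) -> distinct_pos (p 0) ->
  (tag (p n) ==> c) ->
  exists q, [/\ tag q = c, distinct_pos q, (psize (p 0) < psize q)%N,
      forall k, (k <= n)%N -> ext k (p k) q
    & tag (p n) = c -> prolong (p n) q /\ witnessed m (p n) q].
Proof.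
move=> sat inf pres Hp d0 pc.
have [r [pr rk dr]] := chain_pos sat Hp d0.
have [tc|tc] := eqVneq (tag (p n)) c.
  have [q [rq dq sq wq]] := grow_pos m (inf (tag r)) dr.
  exists q; split => //.
  - by rewrite (prolong_tag rq) (prolong_tag pr).
  - by apply: leq_ltn_trans sq; case: (rk 0 (leq0n _)).
  - by move=> k kn; apply: ext_trans (rk k kn) _; exact: prolong_ext.
  - move=> _; split; first exact: prolong_trans pr rq.
    exact: witnessed_prolong pr wq.
have [cT tF] : c = true /\ tag (p n) = false.
  by move: tc pc; case: (tag (p n)); case: c.
(* By [pres] the forall_{n+1}-type of the empty tuple of [St true] is preserved by [r], so lifting
   copies [r] into [St true]. *)
have [|q [q0 rq sq]] := @lift_pos n (mkpos ([::] : seq (St true))) r (sat _).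
  split => // f Pf f0 Hf.
  have sf : sentence f by move=> x /f0.
  have HT : fo_sat (St true) f by apply/(sentence_sat _ sf); exact: Hf.
  suff H : fo_sat (St (tag r)) f by exact: H.
  by rewrite (prolong_tag pr) tF; exact: pres.
have dq : distinct_pos q by apply: ext0_distinct sq dr; exact: ext_le rq.
have [q' [qq' dq' sq' _]] := grow_pos 0 (inf (tag q)) dq.
exists q'; split => //.
- by rewrite (prolong_tag qq') (prolong_tag q0).
- apply: leq_ltn_trans sq'; rewrite sq; by case: (rk 0 (leq0n _)).
- move=> k kn; apply: ext_trans (rk k kn) _.
  by apply: ext_trans (prolong_ext k qq'); exact: ext_le rq.
- by move=> E; rewrite E eqxx in tc.
Qed.

End Positions.

(** * True stages *)

Section Stages.
Implicit Types (y : nat -> bool) (r s t : seq bool).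

(* Latest bit first, so that initial segments become suffixes. *)
Fixpoint pre y (m : nat) : seq bool := if m is m'.+1 then y m' :: pre y m' else [::].

Lemma size_pre y m : size (pre y m) = m.
Proof. by elim: m => //= m ->. Qed.

Lemma pre_agree y z m : agree m y z -> pre y m = pre z m.
Proof.
elim: m => //= m IH H; rewrite IH ?(H m) //.
by move=> i im; apply: H; exact: ltnW.
Qed.

Lemma pre_eq y z m : pre y m = pre z m -> agree m y z.
Proof.
elim: m => [|m IH] //= [ym /IH H] i.
by rewrite ltnS leq_eqVlt => /orP[/eqP->|/H].
Qed.

Lemma suffix_cons s b t : suffix s (b :: t) -> s = b :: t \/ suffix s t.
Proof.
move=> /suffixP[[|a d]] /= H; [by left | right].
by apply/suffixP; case: H => _ ->; exists d.
Qed.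

Lemma suffix_size s t : suffix s t -> (size s <= size t)%N.
Proof. by move=> /suffixP[d ->]; rewrite size_cat leq_addl. Qed.

Lemma suffix_pre s y m : suffix s (pre y m) -> s = pre y (size s).
Proof.
elim: m => [|m IH] /=; first by rewrite suffixs0 => /eqP->.
by move=> /suffix_cons[->|/IH //]; rewrite /= size_pre.
Qed.

Lemma suffix_tree r s t : suffix r t -> suffix s t -> (size r <= size s)%N -> suffix r s.
Proof.
move=> /suffixP[d tE] /suffixP[e]; rewrite tE => E rs; apply/suffixP.
exists (drop (size e) d).
have ed : (size e <= size d)%N.
  have := congr1 size E; rewrite !size_cat => E'.
  by rewrite -(leq_add2r (size s)) -E' leq_add2l.
have := congr1 (drop (size e)) E; rewrite drop_cat drop_size_cat // => <-.
by case: ltngtP ed => // -> _; rewrite drop_size subnn drop0.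
Qed.

Lemma suffix_eq s t : suffix s t -> size s = size t -> s = t.
Proof.
move=> /suffixP[[|a d]] -> //=; rewrite size_cat => /eqP.
by rewrite -addSn -[X in X == _]add0n eqn_add2r.
Qed.

Lemma pre_suffix y m m' : (m <= m')%N -> suffix (pre y m) (pre y m').
Proof.
move=> /subnK <-; elim: (m' - m)%N => [|d IH]; first exact: suffix_refl.
rewrite addSn /=; apply: suffix_trans IH _.
by apply/suffixP; exists [:: y (d + m)%N].
Qed.

(** The branch that [y] selects in the tree [R]: at level 0 it consists of all initial segments, and
    each jump thins it out. *)
Definition true_stages (R : seq bool -> seq bool -> Prop) y (tr : set nat) :=
  [/\ forall L, exists2 m, (L <= m)%N & tr m,
      forall m m', tr m -> tr m' -> (m <= m')%N -> R (pre y m) (pre y m')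
    & forall s m, tr m -> R s (pre y m) -> tr (size s)].

(** * The jump of a true stage relation *)

Section Jump.
Variable R : seq bool -> seq bool -> Prop.
Variable U : nat -> set (seq bool).
Hypothesis Rrefl : forall s, R s s.
Hypothesis Rroot : forall s, R [::] s.
Hypothesis Rtrans : forall r s t, R r s -> R s t -> R r t.
Hypothesis Rsuf : forall s t, R s t -> suffix s t.
Hypothesis Uup : forall j s t, U j s -> R s t -> U j t.

Definition enters i s := U i s /\ forall r, R r s -> (size r < size s)%N -> ~ U i r.

(* As in Dekker's nondeficiency stages: [s] still looks correct at [t] if only indices
   above one that enters at [s] have entered since. *)
Definition jump s t := R s t /\
  (s = [::] \/ forall j, U j t -> ~ U j s -> exists2 i, (i < j)%N & enters i s).

Lemma jump_refl s : jump s s. Proof. by split => //; right => j H /(_ H). Qed.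

Lemma jump_root s : jump [::] s. Proof. by split => //; left. Qed.

(** An index that entered between [r] and [t] either did so by [s], or lies above some [i] entering
    at [s]. Unless [r = s], this [i] is itself new since [r] and lies above an index entering at
    [r]. *)
Lemma jump_trans r s t : jump r s -> jump s t -> jump r t.
Proof.
move=> [Rrs Hrs] [Rst Hst]; split; first exact: Rtrans Rst.
case: Hrs => [|Hrs]; first by left.
case: Hst => [s0|Hst].
  left; move: (Rsuf Rrs); rewrite s0 suffixs0; exact/eqP.
right => j tj rj; have [sj|sj] := pselect (U j s); first exact: Hrs.
have [i ij [si ni]] := Hst j tj sj.
have [ri|ri] := pselect (U i r); last first.
  by have [i' i'i] := Hrs i si ri; exists i' => //; exact: ltn_trans ij.
have := suffix_size (Rsuf Rrs); rewrite leq_eqVlt => /orP[/eqP rs|rs].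
  by exists i => //; rewrite (suffix_eq (Rsuf Rrs) rs).
by case: (ni r Rrs rs ri).
Qed.

(** Whatever has entered by [s] has entered by [t], as [U] is closed upward. *)
Lemma jump_club r s t : R r s -> R s t -> jump r t -> jump r s.
Proof.
move=> Rrs Rst [_ H]; split => //; case: H => [|H]; [by left | right => j sj].
exact/H/(Uup sj).
Qed.

Lemma enters_before j t : U j t -> exists2 s, R s t & enters j s.
Proof.
have [m] := ubnP (size t); elim: m t => // m IH t tm tj.
have [[s [Rst st sj]]|H] := pselect (exists s, [/\ R s t, (size s < size t)%N & U j s]).
  have [|r Rrs rj] := IH s _ sj; first exact: leq_trans st tm.
  by exists r => //; exact: Rtrans Rst.
by exists t => //; split => // r Rrt rt rj; apply: H; exists r.
Qed.

Variables (y : nat -> bool) (tr : set nat).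
Hypothesis trueR : true_stages R y tr.

Definition jump_true : set nat :=
  [set m | tr m /\ forall m', tr m' -> (m <= m')%N -> jump (pre y m) (pre y m')].

Lemma enters_late m m' j : tr m -> tr m' -> (m <= m')%N -> U j (pre y m') -> ~ U j (pre y m) ->
  exists l, [/\ (m < l)%N, tr l & enters j (pre y l)].
Proof.
case: trueR => _ tR tdown tm tm' mm' m'j mj.
have [r Rr rj] := enters_before m'j.
have rE := suffix_pre (Rsuf Rr); have tr_r := tdown _ _ tm' Rr.
exists (size r); split => //; last by rewrite -rE.
rewrite ltnNge; apply/negP => rm; apply: mj; apply: Uup rj.1 _.
by rewrite rE; exact: tR.
Qed.

(** An index enters at most once along the true stages, so those below [b] eventually stop entering.
    Beyond that point, take a true stage at which the least index still to come enters: later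
    entries have larger indices, so it never looks wrong. If nothing more enters, any late true
    stage will do. *)
Lemma jump_true_inf L b :
  exists m, [/\ (L <= m)%N, jump_true m & forall i, (i < b)%N -> ~ enters i (pre y m)].
Proof.
case: (trueR) => tinf tR tdown.
have [L1 LL1 HL1] : exists2 L1, (L <= L1)%N &
    forall i m, (i < b)%N -> (L1 < m)%N -> tr m -> ~ enters i (pre y m).
  elim: b => [|b [L1 LL1 HL1]]; first by exists L.
  have [[m [tm mb]]|H] := pselect (exists m, tr m /\ U b (pre y m)).
    exists (maxn L1 m) => [|i m']; first by rewrite leq_max LL1.
    rewrite ltnS leq_eqVlt gtn_max => /orP[/eqP->|ib] /andP[L1m mm'] tm'; last exact: HL1.
    move=> [_ /(_ (pre y m))]; apply => //; last by rewrite !size_pre.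
    by apply: tR => //; exact: ltnW.
  exists L1 => // i m; rewrite ltnS leq_eqVlt => /orP[/eqP->|ib] L1m tm; last exact: HL1.
  by move=> [mb _]; apply: H; exists m.
have [ex|nex] := pselect (exists i, `[< exists m, [/\ (L1 < m)%N, tr m & enters i (pre y m)] >]).
  have [i /asboolP[m [L1m tm mi]] imin] := ex_minnP ex.
  exists m; split; [by apply: leq_trans LL1 _; exact: ltnW | | by move=> i' i'b; exact: HL1].
  split => // m' tm' mm'; split; first exact: tR.
  right => j m'j mj; have [l [ml tl lj]] := enters_late tm tm' mm' m'j mj.
  exists i => //; rewrite ltn_neqAle; apply/andP; split.
    by apply/eqP => ij; apply: mj; rewrite -ij; case: mi.
  by apply: imin; apply/asboolP; exists l; split => //; exact: ltn_trans ml.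
have [m L1m tm] := tinf L1.+1.
exists m; split; [by apply: leq_trans LL1 _; exact: ltnW | | by move=> i' i'b; exact: HL1].
split => // m' tm' mm'; split; first exact: tR.
right => j m'j mj; have [l [ml tl lj]] := enters_late tm tm' mm' m'j mj.
case: nex; exists j; apply/asboolP; exists l; split => //; exact: ltn_trans ml.
Qed.

Hypothesis Rtree : forall r s t, R r t -> R s t -> (size r <= size s)%N -> R r s.

Lemma true_stages_jump : true_stages jump y jump_true.
Proof.
case: (trueR) => tinf tR tdown; split.
- by move=> L; have [m [Lm tm _]] := jump_true_inf L 0; exists m.
- by move=> m m' [_ H] [tm' _]; exact: H.
- move=> s m [tm Hm] sm; have sE := suffix_pre (Rsuf sm.1).
  have ts := tdown _ _ tm sm.1; split => // m' tm' sm'; rewrite -sE.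
  (* Stages beyond [m] follow by transitivity, those between [s] and [m] by [jump_club]. *)
  have [mm'|m'm] := leqP m m'; first exact: jump_trans sm (Hm m' tm' mm').
  apply: (jump_club _ _ sm); first by rewrite sE; exact: tR.
  by apply: tR => //; exact: ltnW.
Qed.

(** The purpose of the jump: the complement of each [U i] becomes open at the new level. Above a
    jump-true stage at which no index below [i] enters, an entry of [i] would break the jump
    relation. *)
Lemma jump_complement i : (~ exists m, tr m /\ U i (pre y m)) <->
  exists m, jump_true m /\ forall t, jump (pre y m) t -> ~ U i t.
Proof.
case: (trueR) => tinf tR tdown; split.
  (* The bound 1 excludes the root, which precedes every stage whatever enters. *)
  move=> H; have [m [m1 tm mi]] := jump_true_inf 1 i.
  exists m; split => // t [Rt [m0|Ht]] ti.
    by move: (size_pre y m) m1; rewrite m0 => <-.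
  have [|j ji] := Ht i ti; first by move=> mU; apply: H; exists m; case: tm.
  exact: mi.
move=> [m [[tm Hm] Hi]] [m' [tm' m'i]].
have [le|/ltnW le] := leqP m m'; first exact: Hi (Hm m' tm' le) m'i.
by apply: Hi (Uup m'i (tR _ _ tm' tm le)); exact: jump_refl.
Qed.

End Jump.

(** [stages_club] is what the construction of tuples relies on: it compares the last predecessors of
    a stage at consecutive levels. *)
Record stages (k : nat) (le : nat -> seq bool -> seq bool -> Prop) : Prop := {
  stages0 : forall s t, le 0 s t <-> suffix s t;
  stages_refl : forall j s, (j <= k)%N -> le j s s;
  stages_root : forall j s, (j <= k)%N -> le j [::] s;
  stages_trans : forall j r s t, (j <= k)%N -> le j r s -> le j s t -> le j r t;
  stagesS : forall j s t, (j < k)%N -> le j.+1 s t -> le j s t;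
  stages_club : forall j r s t, (j < k)%N ->
    le j r s -> le j s t -> le j.+1 r t -> le j.+1 r s }.

Lemma stages_suffix k le j s t : stages k le -> (j <= k)%N -> le j s t -> suffix s t.
Proof.
move=> Sle; elim: j => [|j IH] jk; first by move=> /(stages0 Sle).
by move=> /(stagesS Sle jk); apply: IH; exact: ltnW.
Qed.

(** Suffixes of one sequence are linearly ordered, and [stages_club] hands this on from level to
    level. *)
Lemma stages_tree k le j r s t : stages k le -> (j <= k)%N ->
  le j r t -> le j s t -> (size r <= size s)%N -> le j r s.
Proof.
move=> Sle; elim: j => [|j IH] jk rt st rs.
  move: rt st => /(stages0 Sle) rt /(stages0 Sle) st.
  by apply/(stages0 Sle); exact: suffix_tree rt st rs.
apply: (stages_club Sle jk _ (stagesS Sle jk st) rt).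
exact: (IH (ltnW jk) (stagesS Sle jk rt) (stagesS Sle jk st) rs).
Qed.

(** A sequence of sets is treated at once because the induction passes from each [A j] to the
    complements of its countably many pieces. These are open at level [k], so after one jump the
    pieces are open, and so is their union. *)
Lemma stages_exist k (A : nat -> set cantor_space) :
  (forall j, SigmaB _ k (A j)) ->
  exists le (U : nat -> set (seq bool)) (tr : cantor_space -> set nat),
  [/\ stages k le, forall y, true_stages (le k) y (tr y),
      forall j s t, U j s -> le k s t -> U j t
    & forall j y, A j y <-> exists m, tr y m /\ U j (pre y m)].
Proof.
elim: k A => [|k IH] A HA.
  (* At level 0, [s] is in [U j] when its cylinder is contained in [A j]. *)
  exists (fun _ s t => suffix s t),
    (fun j => [set s | forall y : cantor_space, suffix s (pre y (size s)) -> A j y]),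
    (fun=> setT); split.
  - split => [//|_ s _|_ s _|_ r s t _ rs st|//|//].
    + exact: suffix_refl.
    + exact: suffix0s.
    + exact: suffix_trans rs st.
  - move=> y; split => // [L|m m' _ _]; [by exists L | exact: pre_suffix].
  - move=> j s t Hs st y ty; apply: Hs.
    have [d tE] : exists d, t = d ++ s by apply/suffixP.
    move: (suffix_trans st ty) => /suffix_pre {1}->; exact: suffix_refl.
  - move=> j y; split.
      move/openP : (HA j) => Ao /Ao[m Hm]; exists m; split => // z.
      rewrite size_pre => H; apply: Hm; apply: pre_eq.
      by apply: suffix_eq H _; rewrite !size_pre.
    by move=> [m [_]]; apply; rewrite size_pre; exact: suffix_refl.
have /choice[F HF] : forall j, exists F : nat -> set cantor_space,
    (forall i, SigmaB _ k (~` F i)) /\ A j = \bigcup_i F i by [].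
have [|le [U [tr [Sle tle Uup UE]]]] := IH (fun m =>
    if @unpickle (nat * nat)%type m is Some ji then ~` F ji.1 ji.2 else ~` F 0 0).
  by move=> m; case: unpickle => [[j i]|]; exact: (HF _).1.
have Rrefl s : le k s s by apply: (stages_refl Sle).
have Rroot s : le k [::] s by apply: (stages_root Sle).
have Rtrans r s t : le k r s -> le k s t -> le k r t by exact: (stages_trans Sle (leqnn k)).
have Rsuf s t : le k s t -> suffix s t by exact: (stages_suffix Sle (leqnn k)).
pose J := jump (le k) U.
(* For some [i], as far as [J] can see from [s], the complement of [F j i] is never entered. *)
pose V (j : nat) : set (seq bool) := [set s | exists i : nat, forall t, J s t -> ~ U (pickle (j, i)) t].
have Jtrans := @jump_trans _ U Rtrans Rsuf.
exists (fun j => if (j <= k)%N then le j else J), V, (fun y => jump_true (le k) U y (tr y)); split.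
- split => //=.
  + exact: stages0 Sle.
  + move=> j s _; case: leqP => jk; [exact: (stages_refl Sle) | exact: jump_refl].
  + move=> j s _; case: leqP => jk; [exact: (stages_root Sle) | exact: jump_root].
  + move=> j r s t _; case: leqP => jk; [exact: (stages_trans Sle jk) | exact: (Jtrans r s t)].
  + move=> j s t; rewrite ltnS => jk; rewrite jk; case: ltnP => jk'; first exact: (stagesS Sle jk').
    have -> : j = k by apply/eqP; rewrite eqn_leq jk.
    by case.
  + move=> j r s t; rewrite ltnS => jk; rewrite jk; case: ltnP => jk'; first exact: (stages_club Sle jk').
    have -> : j = k by apply/eqP; rewrite eqn_leq jk.
    exact: jump_club.
- by move=> y; rewrite ltnn; apply: true_stages_jump.
- move=> j s t [i Hi]; rewrite ltnn => st; exists i => u tu; apply: Hi.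
  exact: (Jtrans _ _ _ st tu).
- move=> j y; rewrite (HF j).2.
  have FE i : F j i y <-> ~ exists m, tr y m /\ U (pickle (j, i)) (pre y m).
    by rewrite -UE pickleK /=; split => [? //|/contrapT].
  have JE i := jump_complement Rrefl Rtrans Rsuf Uup (tle y) (pickle (j, i)).
  split=> [[i _ /FE/JE[m [tm Hm]]]|[m [tm [i Hi]]]]; first by exists m; split => //; exists i.
  by exists i => //; apply/FE/JE; exists m.
Qed.

End Stages.

(** * The reduction *)

Section Limit.
Variables (sym : countType) (ar : sym -> nat) (St : bool -> structure ar).
Variables (x : cantor_space) (q : nat -> pos St) (tr : set nat) (c : bool).
Notation form := (fo_form ar).
Hypothesis q_distinct : forall m, distinct_pos (q m).
Hypothesis q_size : forall m, (m <= psize (q m))%N.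
Hypothesis q_rel : forall m (R : sym) (a : 'I_(ar R) -> nat),
  (forall i, (a i < psize (q m))%N) ->
  interp (s := struct_of ar x) a <-> fo_eval (pval (q m)) (FRel a).
Hypothesis tr_inf : forall L, exists2 m, (L <= m)%N & tr m.
Hypothesis q_prolong : forall m m', tr m -> tr m' -> (m < m')%N ->
  prolong (q m) (q m') /\ witnessed m' (q m) (q m').

Definition limit_agrees (f : form) := forall (w : nat -> nat) m, tr m ->
  (forall y, fo_free y f -> (w y < psize (q m))%N) ->
  @fo_eval _ _ (struct_of ar x) w f <-> fo_eval (fun y => pval (q m) (w y)) f.

(** One way, the witness is a number, and a number is an index into every late enough tuple. The
    other way, the instance is a request, served between two true stages. *)
Lemma limit_ex z f : limit_agrees f -> limit_agrees (FEx z f).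
Proof.
move=> IH w m tm wf /=; pose F : form := FEx z f.
have later L : exists m', [/\ (L < m')%N, tr m', (m < m')%N & prolong (q m) (q m')].
  have [m' Lm' tm'] := tr_inf (maxn L m).+1.
  move: Lm'; rewrite gtn_max => /andP[Lm' mm']; exists m'; split => //.
  by case: (q_prolong tm tm' mm').
have updE p i : upd (fun y => pval p (w y)) z (pval p i) = fun y => pval p (upd w z i y).
  by apply/funext => y; rewrite /upd; case: ifP.
split=> [[i Hi]|Hex].
  have [m' [im' tm' mm' qmm']] := later i.
  apply/(prolong_eval (f := F) qmm' wf); exists (pval (q m') i).
  rewrite updE; apply/IH => // y fy; rewrite /upd; case: eqVneq => [_|/eqP yz].
    exact: leq_trans im' (q_size m').
  by apply: leq_trans (prolong_size qmm'); apply: wf => /=; split => // zy; apply: yz.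
(* A positive stage has a nonempty tuple, so index 0 can be the default in [ws]. *)
have [m1 [m1_gt0 tm1 mm1 qmm1]] := later 0.
have {}Hex : fo_eval (fun y => pval (q m1) (w y)) F by apply/(prolong_eval (f := F) qmm1 wf).
pose w0 y := if `[< fo_free y F >] then w y else 0.
have [b Hb] := fo_free_bound F.
pose ws := mkseq w0 b.
have wsE y : fo_free y F -> nth 0 ws y = w y.
  move=> Fy; rewrite nth_mkseq; last exact: Hb.
  by rewrite /w0; case: asboolP.
have ws_lt y : (nth 0 ws y < psize (q m1))%N.
  have [yb|yb] := ltnP y b; last first.
    by rewrite nth_default ?size_mkseq //; exact: leq_trans m1_gt0 (q_size m1).
  rewrite nth_mkseq // /w0; case: asboolP => Fy; last exact: leq_trans m1_gt0 (q_size m1).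
  exact: leq_trans (wf y Fy) (prolong_size qmm1).
have [a aE] := nth_form_surj f.
pose e := pickle (a, z, ws).
have [m2 [em2 tm2]] : exists m2, (maxn e m1 < m2)%N /\ tr m2.
  by have [m2 ? ?] := tr_inf (maxn e m1).+1; exists m2.
move: em2; rewrite gtn_max => /andP[em2 m12].
have [qm12 /(_ e em2)] := q_prolong tm1 tm2 m12.
rewrite /req pickleK aE => /(_ ws_lt) [|i [im2 Hi]].
  case: Hex => d Hd; exists d; move: Hd; apply: (fo_eval_ext _).1 => y fy.
  rewrite /upd; case: eqVneq => // /eqP yz; rewrite wsE //=.
  by split => // zy; apply: yz.
have fw y : fo_free y f -> upd (nth 0 ws : nat -> struct_of ar x) z i y = upd (w : nat -> struct_of ar x) z i y.
  move=> fy; rewrite /upd; case: eqVneq => // /eqP yz; rewrite wsE //=.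
  by split => // zy; apply: yz.
exists i; apply/(IH _ m2) => //.
  move=> y fy; rewrite -fw // /upd; case: eqVneq => // _.
  exact: leq_trans (ws_lt y) (prolong_size qm12).
by move: Hi; apply: (fo_eval_ext _).1 => y fy; congr pval; exact: fw.
Qed.

Lemma limit_neg f : limit_agrees f -> limit_agrees (FNeg f).
Proof. by move=> IH w m tm wf /=; rewrite (IH w m tm wf). Qed.

Lemma limitP f : limit_agrees f.
Proof.
elim: f => [|a b|R a|f IH|f IHf g IHg|f IHf g IHg|f IHf g IHg|z f IH|z f IH].
- by [].
- move=> w m tm wf /=; split => [-> //|]; apply: q_distinct; apply: wf; by [left | right].
- move=> w m tm wf; apply: (q_rel (a := fun i => w (a i))) => i.
  by apply: wf; exists i.
- exact: limit_neg.
- move=> w m tm wf /=.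
  by rewrite (IHf w m tm (fun y H => wf y (or_introl H))) (IHg w m tm (fun y H => wf y (or_intror H))).
- move=> w m tm wf /=.
  by rewrite (IHf w m tm (fun y H => wf y (or_introl H))) (IHg w m tm (fun y H => wf y (or_intror H))).
- move=> w m tm wf /=.
  by rewrite (IHf w m tm (fun y H => wf y (or_introl H))) (IHg w m tm (fun y H => wf y (or_intror H))).
- have IH' := limit_neg (limit_ex (z := z) (limit_neg IH)).
  have allE (M : structure ar) (v : nat -> M) :
      fo_eval v (FAll z f) <-> fo_eval v (FNeg (FEx z (FNeg f))).
    split => /= [H [d]|H d]; first exact.
    by apply: contrapT => nd; apply: H; exists d.
  by move=> w m tm wf; rewrite !allE; exact: IH'.
- exact: limit_ex.
Qed.

Hypothesis q_tag : forall m, tr m -> tag (q m) = c.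

Lemma limit_sat f : sentence f -> fo_sat (struct_of ar x) f <-> fo_sat (St c) f.
Proof.
move=> sf; have [m _ tm] := tr_inf 0; rewrite -(q_tag tm).
rewrite (sentence_sat (fun=> 0 : struct_of ar x) sf) (limitP tm); last by move=> y /sf.
by rewrite -(sentence_sat _ sf).
Qed.

End Limit.

Section Reduction.
Variables (sym : countType) (ar : sym -> nat) (St : bool -> structure ar) (n : nat).
Hypothesis St_sat : forall c, saturated (St c).
Hypothesis St_inf : forall c, infinite_structure (St c).
Hypothesis St_pres : forall f, sentence f -> PiF n.+1 f ->
  fo_sat (St true) f -> fo_sat (St false) f.
Variables (le : nat -> seq bool -> seq bool -> Prop) (V : set (seq bool)).
Hypothesis Sle : stages n le.
Hypothesis Vup : forall s t, V s -> le n s t -> V t.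

Definition inV (t : seq bool) : bool := `[< V t >].

Lemma inV_le s t : le n s t -> inV s ==> inV t.
Proof. by move=> st; apply/implyP => /asboolP Vs; apply/asboolP; exact: Vup st. Qed.

(** [h] is the history, consulted only at proper predecessors of [t]. Prolongation is demanded only
    at the top level, between stages that agree about [V]. *)
Definition good (h : seq bool -> pos St) (t : seq bool) (p : pos St) : Prop :=
  [/\ tag p = inV t, distinct_pos p, (size t <= psize p)%N,
      forall k s, (k <= n)%N -> le k s t -> (size s < size t)%N -> ext k (h s) p
    & forall s, le n s t -> (size s < size t)%N -> inV s = inV t ->
        prolong (h s) p /\ witnessed (size t) (h s) p].

Lemma last_pred k t : (k <= n)%N -> t != [::] -> exists s, [/\ le k s t, (size s < size t)%N
  & forall r, le k r t -> (size r < size t)%N -> (size r <= size s)%N].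
Proof.
move=> kn t0.
pose P m := `[< exists s, [/\ le k s t, (size s < size t)%N & size s = m] >].
have ex : exists m, P m.
  exists 0; apply/asboolP; exists [::]; split => //; first exact: (stages_root Sle).
  by case: (t) t0.
have bd m : P m -> (m <= size t)%N by move=> /asboolP[s [_ /ltnW st <-]].
case: (ex_maxnP ex bd) => m /asboolP[s [st lts sm]] mmax.
exists s; split => // r rt ltr; rewrite sm; apply: mmax; apply/asboolP.
by exists r.
Qed.

(** The last predecessor [s k] of [u] at level [k] controls all the others, since they form a chain
    below it; thus [next_pos] applied to the tuples at the [s k] suffices. *)
Lemma good_step (h : seq bool -> pos St) b t :
  (forall s, suffix s t -> good h s (h s)) -> exists p, good h (b :: t) p.
Proof.
move=> Hh; set u := b :: t.
have sufl k s : (k <= n)%N -> le k s u -> (size s < size u)%N -> suffix s t.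
  move=> kn su lts; have /suffix_cons[sE|//] := stages_suffix Sle kn su.
  by rewrite sE ltnn in lts.
have /choice[s Hs] : forall k, exists s, (k <= n)%N -> [/\ le k s u, (size s < size u)%N
    & forall r, le k r u -> (size r < size u)%N -> (size r <= size s)%N].
  move=> k; have [kn|_] := boolP (k <= n)%N; last by exists [::].
  by have [s Hs] := @last_pred k u kn isT; exists s.
have le_s k r : (k <= n)%N -> le k r u -> (size r < size u)%N -> le k r (s k).
  move=> kn ru ltr; have [su lts smax] := Hs k kn.
  exact: (stages_tree Sle kn ru su (smax r ru ltr)).
have ext_s k r : (k <= n)%N -> le k r (s k) -> ext k (h r) (h (s k)).
  move=> kn rs; have [su lts smax] := Hs k kn.
  have suf := stages_suffix Sle kn rs.
  have := suffix_size suf; rewrite leq_eqVlt => /orP[/eqP rsE|rsl].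
    by rewrite (suffix_eq suf rsE); exact: ext_refl.
  by have [_ _ _ H _] := Hh _ (sufl k _ kn su lts); exact: H.
have tag_s k : (k <= n)%N -> tag (h (s k)) = inV (s k).
  by move=> kn; have [su lts _] := Hs k kn; case: (Hh _ (sufl k _ kn su lts)).
have s0E : s 0 = t.
  have [su lts smax] := Hs 0 (leq0n _).
  apply: suffix_eq; first exact: (sufl 0).
  apply/eqP; rewrite eqn_leq -ltnS lts /=; apply: smax => //.
  by apply/(stages0 Sle)/suffixP; exists [:: b].
have [_ dt szt _ _] := Hh t (suffix_refl t).
have [] := @next_pos _ _ St n (size u) (inV u) (fun k => h (s k)) St_sat St_inf St_pres.
- move=> k kn; have [su lts smax] := Hs k.+1 kn.
  have [su' lts' _] := Hs k (ltnW kn).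
  (* [s k.+1] also precedes [u] at level [k], hence lies below [s k]; as [s k] is between it and
     [u], [stages_club] raises this to level [k.+1]. *)
  have sk : le k (s k.+1) (s k) by apply: le_s => //; [exact: ltnW | exact: (stagesS Sle kn)].
  have sk1 := stages_club Sle kn sk su' su.
  have suf := stages_suffix Sle (ltnW kn) sk.
  have := suffix_size suf; rewrite leq_eqVlt => /orP[/eqP rsE|rsl].
    by rewrite (suffix_eq suf rsE); exact: ext_refl.
  by have [_ _ _ H _] := Hh _ (sufl k _ (ltnW kn) su' lts'); exact: H.
- by rewrite s0E.
- by rewrite tag_s //; apply: inV_le; case: (Hs n (leqnn n)).
move=> p [tp dp szp extp prop]; exists p; split => //.
- by apply: leq_ltn_trans szp; rewrite s0E.
- move=> k r kn ru ltr; apply: ext_trans (extp k kn).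
  by apply: ext_s => //; exact: le_s.
- move=> r ru ltr ruV; have [su lts _] := Hs n (leqnn n).
  have rs := le_s n r (leqnn n) ru ltr.
  (* [V] is closed upward and [s n] lies between [r] and [u], which agree. *)
  have snV : inV (s n) = inV u.
    move: (inV_le rs) (inV_le su); rewrite ruV.
    by case: (inV (s n)); case: (inV u).
  have [ps wp] : prolong (h (s n)) p /\ witnessed (size u) (h (s n)) p.
    by apply: prop; rewrite tag_s.
  have pr : prolong (h r) (h (s n)).
    have suf := stages_suffix Sle (leqnn n) rs.
    have := suffix_size suf; rewrite leq_eqVlt => /orP[/eqP rsE|rsl].
      by rewrite (suffix_eq suf rsE); exact: prolong_refl.
    have [_ _ _ _ H] := Hh _ (sufl n _ (leqnn n) su lts).
    by apply: (H r rs rsl _).1; rewrite ruV snV.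
  by split; [exact: prolong_trans pr ps | exact: witnessed_prolong pr wp].
Qed.

Lemma good_ext h h' t p : (forall s, suffix s t -> (size s < size t)%N -> h s = h' s) ->
  good h t p -> good h' t p.
Proof.
move=> hh [tp dp sp ep pp]; split => // [k s kn st lts|s st lts].
  by rewrite -hh //; [exact: ep | exact: stages_suffix Sle kn st].
by rewrite -hh //; [exact: pp | exact: stages_suffix Sle (leqnn n) st].
Qed.

(** Course-of-values recursion: [Q t] stores the choices made at the suffixes of [t]. Among the
    suffixes of [b :: t'] only the whole sequence is longer than [t'], so sizes tell old from
    new. *)
Lemma good_exists : exists q : seq bool -> pos St, forall t, good q t (q t).
Proof.
have /choice[step Hstep] : forall ht : (seq bool -> pos St) * seq bool, exists p,
    (exists p, good ht.1 ht.2 p) -> good ht.1 ht.2 p.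
  move=> ht; have [[p Hp]|nH] := pselect (exists p, good ht.1 ht.2 p); first by exists p.
  by exists (@mkpos _ _ St true [::]).
pose fix Q (t : seq bool) : seq bool -> pos St :=
  if t is b :: t' then fun s => if (size s <= size t')%N then Q t' s else step (Q t', t)
  else fun=> @mkpos _ _ St (inV [::]) [::].
pose q t := Q t t.
have Qq t s : suffix s t -> Q t s = q s.
  elim: t => [|b t IH]; first by rewrite suffixs0 => /eqP->.
  by move=> /suffix_cons[-> //|st]; rewrite /= (suffix_size st) IH.
have Gq t : forall s, suffix s t -> good q s (q s).
  elim: t => [|b t IH] s.
    by rewrite suffixs0 => /eqP->; split.
  move=> /suffix_cons[->|]; last exact: IH.
  have qE : q (b :: t) = step (Q t, b :: t) by rewrite /q /= ltnn.
  have Qs r : suffix r (b :: t) -> (size r < size (b :: t))%N -> Q t r = q r.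
    by move=> /suffix_cons[->|rt _]; [rewrite ltnn | exact: Qq].
  rewrite qE; apply: (good_ext Qs); apply: (Hstep (Q t, b :: t)).
  have [p Hp] := good_step b IH; exists p; move: Hp; apply: good_ext => r rs ltr.
  exact/esym/(Qs r rs ltr).
by exists q => t; apply: (Gq t); exact: suffix_refl.
Qed.

End Reduction.

(** * Continuity of the reduction and the lower bound *)

Section Hardness.
Variables (sym : countType) (ar : sym -> nat).

Lemma ext0_FRel (St : bool -> structure ar) (p q : pos St) (R : sym) (a : 'I_(ar R) -> nat) :
  ext 0 p q -> (forall i, (a i < psize p)%N) ->
  fo_eval (pval p) (FRel a) <-> fo_eval (pval q) (FRel a).
Proof.
move=> [_ H] ap; have fa y : fo_free y (FRel a) -> (y < psize p)%N by move=> [i <-].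
split => [Hp|Hq]; first by apply: H => //; constructor.
by apply: contrapT => np; apply: (H (FNeg (FRel a))) Hq => //; constructor.
Qed.

Lemma reduce_to_pair (St : bool -> structure ar) n (A : set cantor_space) :
  (forall c, saturated (St c)) -> (forall c, infinite_structure (St c)) ->
  (forall f, sentence f -> PiF n.+1 f -> fo_sat (St true) f -> fo_sat (St false) f) ->
  SigmaB cantor_space n A ->
  exists F : cantor_space -> cantor_space, [/\ continuous F, forall y, ModTau ar (F y)
    & forall y f, sentence f -> fo_sat (struct_of ar (F y)) f <-> fo_sat (St `[< A y >]) f].
Proof.
move=> sat inf pres SA.
have [le [U [tr [Sle tle Uup UE]]]] := @stages_exist n (fun=> A) (fun=> SA).
have [q Gq] := good_exists sat inf pres Sle (Uup 0).
have qpre y m m' : (m <= m')%N -> ext 0 (q (pre y m)) (q (pre y m')).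
  rewrite leq_eqVlt => /orP[/eqP->|mm']; first exact: ext_refl.
  have [_ _ _ H _] := Gq (pre y m'); apply: H; rewrite ?size_pre //.
  by apply/(stages0 Sle)/pre_suffix; exact: ltnW.
have qsz y m : (m <= psize (q (pre y m)))%N.
  by have [_ _ + _ _] := Gq (pre y m); rewrite size_pre.
(* At length [bd c] the tuple covers all arguments of the fact [c], so finitely many bits of [y]
   decide it; other stages that cover them agree by [ext 0]. *)
pose bd (c : fact ar) := (\max_i tagged c i).+1.
pose F (y : cantor_space) : cantor_space := fun k =>
  if @pickle_inv (fact ar) k is Some c
  then `[< fo_eval (pval (q (pre y (bd c)))) (FRel (fun i => tagged c i)) >] else false.
exists F; split.
- apply: continuous_agree => k; rewrite /F; case: pickle_inv => [c|]; last by exists 0.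
  by exists (bd c) => y z /pre_agree ->.
- move=> y k; rewrite /F; have := @pickle_invK (fact ar) k.
  by case: pickle_inv => //= c; exists c.
have Frel y m (R : sym) (a : 'I_(ar R) -> nat) :
    (forall i, (a i < psize (q (pre y m)))%N) ->
    interp (s := struct_of ar (F y)) a <-> fo_eval (pval (q (pre y m))) (FRel a).
  move=> am; rewrite /= /F /code_fact pickleK_inv.
  set c : fact ar := Tagged _ _.
  have -> : (fun i => tagged c i) = a by apply/funext => i; rewrite ffunE.
  have ab i : (a i < psize (q (pre y (bd c))))%N.
    apply: leq_trans (qsz y (bd c)); rewrite ltnS.
    by have := @leq_bigmax _ (fun i => tagged c i) i; rewrite /= ffunE.
  have -> : (`[< fo_eval (pval (q (pre y (bd c)))) (FRel a) >] = true) <->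
      fo_eval (pval (q (pre y (bd c)))) (FRel a) by split => [/asboolP|/asboolP].
  have [le_m|/ltnW le_m] := leqP (bd c) m; first exact: (ext0_FRel (qpre y _ _ le_m)).
  exact: iff_sym (ext0_FRel (qpre y _ _ le_m) am).
move=> y f sf; case: (tle y) => tinf tR _.
(* Outside [A] no true stage is in [U 0]; inside [A] all are from some stage on. The limit is taken
   along the true stages past [m0], where the structure is fixed. *)
have [m0 Hm0] : exists m0, forall m, tr y m -> (m0 <= m)%N -> inV (U 0) (pre y m) = `[< A y >].
  case: asboolP => Ay; last first.
    exists 0 => m tm _; apply/asboolP => mU; apply: Ay; apply/(UE 0).
    by exists m.
  have [m0 [tm0 m0U]] := (UE 0 y).1 Ay; exists m0 => m tm m0m; apply/asboolP.
  exact: Uup m0U (tR _ _ tm0 tm m0m).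
apply: (@limit_sat _ _ St (F y) (fun m => q (pre y m)) (fun m => tr y m /\ (m0 <= m)%N)) => //.
- by move=> m; case: (Gq (pre y m)).
- exact: Frel.
- move=> L; have [m] := tinf (maxn L m0).
  by rewrite geq_max => /andP[Lm m0m] tm; exists m.
- move=> m m' [tm m0m] [tm' m0m'] mm'.
  have [_ _ _ _] := Gq (pre y m'); rewrite size_pre; apply; rewrite ?size_pre //.
    by apply: tR => //; exact: ltnW.
  by rewrite !Hm0.
- by move=> m [tm m0m]; rewrite -(Hm0 m tm m0m); case: (Gq (pre y m)).
Qed.

Lemma hard_of_no_axiomatization (T : set (fo_form ar)) n :
  (forall f, T f -> sentence f) -> ~ has_forall_axiomatization T n.+1 ->
  hard ar (Sigma0 cantor_space n.+1) (ModT T).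
Proof.
move=> Ts nax A SA.
have [M [N [[satM satN] [infM infN] NT [g Tg nMg] pres]]] := model_pair Ts nax.
have [| | |F [cF FM FE]] := @reduce_to_pair (fun c => if c then N else M) n A _ _ _ SA.
- by case.
- by case.
- exact: pres.
exists F; split => //; split => // y; split.
  move=> Ay; split => // f Tf; apply/(FE y f (Ts f Tf)).
  by case: asboolP => // _; exact: NT.
move=> [_ HT]; apply: contrapT => nAy; apply: nMg.
by have := (FE y g (Ts g Tg)).1 (HT g Tg); case: asboolP.
Qed.

Lemma struct_of_infinite x : infinite_structure (struct_of ar x).
Proof. by exists id. Qed.

End Hardness.

(** * Upper bounds from the syntax *)

Section Complexity.

Lemma clopenC (A : set cantor_space) : Sigma0 cantor_space 0 A -> Sigma0 cantor_space 0 (~` A).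
Proof. by move=> [oA cA]; split; [exact: closed_openC | exact: open_closedC]. Qed.

Lemma clopenI (A B : set cantor_space) : Sigma0 cantor_space 0 A ->
  Sigma0 cantor_space 0 B -> Sigma0 cantor_space 0 (A `&` B).
Proof. by move=> [oA cA] [oB cB]; split; [exact: openI | exact: closedI]. Qed.

Lemma clopenU (A B : set cantor_space) : Sigma0 cantor_space 0 A ->
  Sigma0 cantor_space 0 B -> Sigma0 cantor_space 0 (A `|` B).
Proof. by move=> [oA cA] [oB cB]; split; [exact: openU | exact: closedU]. Qed.

Lemma clopen_const (P : Prop) : Sigma0 cantor_space 0 [set _ | P].
Proof.
have [HP|nP] := pselect P.
  have -> : [set _ : cantor_space | P] = setT by rewrite predeqE.
  by split; [exact: openT | exact: closedT].
have -> : [set _ : cantor_space | P] = set0 by rewrite predeqE.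
by split; [exact: open0 | exact: closed0].
Qed.

Lemma clopen_bit k : Sigma0 cantor_space 0 [set x : cantor_space | x k = true].
Proof.
split; first by apply/openP => x /= xk; exists k.+1 => z /(_ k (ltnSn k)) <-.
rewrite -[X in closed X]setCK; apply: open_closedC.
by apply/openP => x /= xk; exists k.+1 => z /(_ k (ltnSn k)) <-.
Qed.

Lemma Sigma0_clopen n (A : set cantor_space) :
  Sigma0 cantor_space 0 A -> Sigma0 cantor_space n A.
Proof. by case: n => // n [oA /closed_openC cA]; exact: SigmaB_clopen. Qed.

Lemma Sigma0_Pi0S n (A : set cantor_space) :
  Sigma0 cantor_space n A -> Pi0 cantor_space n.+1 A.
Proof.
case: n => [[_] /closed_openC //|n SA].
by apply: (@SigmaB_compl _ n (~` A)); rewrite setCK.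
Qed.

Lemma Pi0_Sigma0S n (A : set cantor_space) :
  Pi0 cantor_space n A -> Sigma0 cantor_space n.+1 A.
Proof.
case: n => [[_ /closed_openC]|n SA]; first by rewrite setCK.
exact: (@SigmaB_compl _ n A).
Qed.

Lemma Pi0_bigcap n (F : nat -> set cantor_space) :
  (forall i, Pi0 cantor_space n.+1 (F i)) -> Pi0 cantor_space n.+1 (\bigcap_i F i).
Proof. by move=> H; rewrite /Pi0 /mkset setC_bigcap; exact: (@SigmaB_bigcup _ n). Qed.

Lemma Pi0_preimage n (f : cantor_space -> cantor_space) A : continuous f ->
  Pi0 cantor_space n.+1 A -> Pi0 cantor_space n.+1 (f @^-1` A).
Proof. by move=> cf HA; exact: (@SigmaB_preimage _ _ f n (~` A)). Qed.

Variables (sym : countType) (ar : sym -> nat).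

Lemma qfree_clopen (f : fo_form ar) (w : nat -> nat) : qfree f ->
  Sigma0 cantor_space 0 [set x | @fo_eval _ _ (struct_of ar x) w f].
Proof.
elim: f => //= [|a b|R a|f IHf /IHf|f IHf g IHg [/IHf Hf /IHg Hg]|f IHf g IHg [/IHf Hf /IHg Hg]|f IHf g IHg [/IHf Hf /IHg Hg]].
- by move=> _; exact: clopen_const.
- by move=> _; exact: clopen_const.
- by move=> _; exact: clopen_bit.
- exact: clopenC.
- exact: clopenI.
- exact: clopenU.
- have -> : [set x : cantor_space | fo_eval (M := struct_of ar x) w f -> fo_eval (M := struct_of ar x) w g]
      = ~` [set x | fo_eval (M := struct_of ar x) w f] `|` [set x | fo_eval (M := struct_of ar x) w g].
    by rewrite predeqE => x /=; rewrite implyE.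
  by apply: clopenU => //; exact: clopenC.
Qed.

Lemma PiSigF_Borel :
  (forall n (f : fo_form ar), PiF n f -> forall w : nat -> nat,
     Pi0 cantor_space n [set x | @fo_eval _ _ (struct_of ar x) w f]) /\
  (forall n (f : fo_form ar), SigF n f -> forall w : nat -> nat,
     Sigma0 cantor_space n [set x | @fo_eval _ _ (struct_of ar x) w f]).
Proof.
apply: (@PiSigF_ind sym ar
  (fun n f => forall w : nat -> nat, Pi0 cantor_space n [set x | @fo_eval _ _ (struct_of ar x) w f])
  (fun n f => forall w : nat -> nat, Sigma0 cantor_space n [set x | @fo_eval _ _ (struct_of ar x) w f])).
- by move=> f qf w; apply: clopenC; exact: qfree_clopen.
- by move=> n f _ H w; exact: Sigma0_Pi0S.
- move=> n z f _ H w; have := Pi0_bigcap (fun m => H (upd w z m)).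
  by congr Pi0; rewrite predeqE => x /=; split => [Hx m|Hx m _]; exact: Hx.
- by move=> f qf w; exact: qfree_clopen.
- by move=> n f _ H w; exact: Pi0_Sigma0S.
- move=> n z f _ H w; have := SigmaB_bigcup (fun m => H (upd w z m)).
  by congr SigmaB; rewrite predeqE => x /=; split => [[m _ Hx]|[m Hx]]; exists m.
Qed.

Lemma Pi0_ModTau n : Pi0 cantor_space n.+1 (ModTau ar).
Proof.
have -> : ModTau ar = \bigcap_k (~` [set x : cantor_space | x k = true] `|`
    [set _ | exists c : fact ar, pickle c = k]).
  rewrite predeqE => x /=; split => [Hx k _|Hx k] /=; first by rewrite -implyE; exact: Hx.
  by have := Hx k I; rewrite /= -implyE.
apply: Pi0_bigcap => k; apply: (@Sigma0_clopen n.+1); apply: clopenC.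
by apply: clopenU; [apply: clopenC; exact: clopen_bit | exact: clopen_const].
Qed.

(** [Ax] and [T] have the same infinite models, in particular the same models with universe omega,
    and each of the countably many possible axioms contributes one set to an intersection. *)
Lemma Pi0_ModT (T : set (fo_form ar)) n : (forall f, T f -> sentence f) ->
  has_forall_axiomatization T n.+1 -> Pi0 cantor_space n.+1 (ModT T).
Proof.
move=> Ts [Ax [AxP Axeq]].
pose F i : set cantor_space := if i is e.+1 then
    (if `[< Ax (nth_form ar e) >] then
       [set x | @fo_eval _ _ (struct_of ar x) (fun=> 0) (nth_form ar e)] else [set _ | True])
  else ModTau ar.
have -> : ModT T = \bigcap_i F i.
  rewrite predeqE => x; split.
    move=> [xm HT] [|e] _ //=; case: asboolP => // Axe.
    have [_ H] : conseq T (nth_form ar e).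
      apply/Axeq; split; first by case: (AxP _ Axe).
      by move=> M _; apply.
    exact: (H _ (struct_of_infinite ar x) HT).
  move=> H; split; first exact: (H 0 I).
  move=> f Tf; have [_ Hf] : conseq Ax f.
    by apply/Axeq; split; [exact: Ts | move=> M _; apply].
  apply: Hf; first exact: struct_of_infinite.
  move=> g Ag; have [sg _] := AxP g Ag; have [e eE] := nth_form_surj g.
  have := H e.+1 I; rewrite /= eE; case: asboolP => // _ Hx.
  exact/(sentence_sat (fun=> 0 : struct_of ar x) sg).
apply: Pi0_bigcap => -[|e] /=; first exact: Pi0_ModTau.
case: asboolP => Axe; first exact: (PiSigF_Borel.1 _ _ (AxP _ Axe).2 (fun=> 0)).
by apply: (@Sigma0_clopen n.+1); apply: clopenC; exact: clopen_const.
Qed.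

(** Otherwise every Sigma set of this level, as a continuous preimage of [B], would also be Pi,
    against the strictness of the hierarchy. *)
Lemma not_Pi0_hard n B : Pi0 cantor_space n.+1 B ->
  ~ hard ar (Sigma0 cantor_space n.+1) B.
Proof.
move=> PB hB; have [A [SA nPA]] := SigmaB_not_compl n.
have [f [cf [_ fA]]] := hB A SA; apply: nPA.
have -> : A = f @^-1` B by rewrite predeqE => y; exact: fA.
exact: Pi0_preimage PB.
Qed.

End Complexity.

Theorem theorem4p18 (sym : countType) (arity : sym -> nat) (T : set (fo_form arity))
    (n : nat) :
  (forall f, T f -> sentence f) -> (2 <= n)%N ->
  (has_forall_axiomatization T n /\ ~ has_forall_axiomatization T n.-1) <->
  (Pi0 cantor_space n (ModT T) /\
   hard arity (Sigma0 cantor_space n.-1) (ModT T)).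
Proof.
case: n => [|[|n]] // Ts _; rewrite -[n.+2.-1]/n.+1; split=> [[ax nax]|[PT hT]].
  by split; [exact: (Pi0_ModT Ts ax) | exact: (hard_of_no_axiomatization Ts nax)].
split; last by move=> ax; exact: (not_Pi0_hard (Pi0_ModT Ts ax) hT).
(* Hardness is used one level higher: without a forall_n-axiomatization, [ModT T] would be
   Sigma^0_n-hard while lying in Pi^0_n. *)
apply: contrapT => nax; exact: (not_Pi0_hard PT (hard_of_no_axiomatization Ts nax)).
Qed.
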